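(* Let $E\subset\partial D$ be a nonempty union of open intervals (arcs) with $0<\mathcal{H}^1(E)<2\pi$, and let $\alpha,\beta,\gamma\in\mathbb{R}$ be given with $\alpha>0$ and $\gamma\ge 0$. There exist a sequence $V_n=(a_n,b_n)\in C^\infty(\overline{D},\mathbb{R}^2)$, $n\in\mathbb{N}$, and a constant $C<\infty$ with $\|\nabla V_n\|_{L^{2,1}(D)}<C$ for all $n$, with the following property: if $u_n\in W^{1,1}(D)$ is the solution to $$\begin{cases}-\Delta u_n=\det(\nabla V_n)&\text{in } D,\\ \alpha\,\dfrac{\partial u_n}{\partial\nu}+\beta\,\dfrac{\partial u_n}{\partial\tau}+\gamma\,u_n=0&\text{on } E,\\ u_n=0&\text{on }\partial D\setminus E,\end{cases}$$ then $$\|\nabla u_n\|_{L^2(D)}\to\infty\qquad\text{as } n\to\infty.$$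
   Context: $D\subset\mathbb{R}^2$ is the open unit disc, $\nu$ its outer unit normal, $\tau$ the counterclockwise unit tangent on $\partial D$, and $\mathcal{H}^1$ is one-dimensional Hausdorff measure (arc length on $\partial D$). The boundary value problem with right-hand side $f\in L^1(D)$ is understood in the weak sense: $u\in W^{1,1}(D)$ is a solution if its trace vanishes $\mathcal{H}^1$-a.e. on $\partial D\setminus E$ and $$\alpha\int_D\big(\nabla u\cdot\nabla\psi-f\psi\big)-\beta\int_{\partial D}u\,\frac{\partial\psi}{\partial\tau}+\gamma\int_{\partial D}u\,\psi=0$$ for all $\psi\in C^1(\overline{D})$ with $\psi=0$ on $\partial D\setminus E$. (The $\beta$-term is the weak form of $\beta\int_{\partial D}\frac{\partial u}{\partial\tau}\psi$.) The convention $\|\nabla u\|_{L^2(D)}=\infty$ is used if $\nabla u\notin L^2(D)$. For a measurable function $g$ on $D$, let $\mu_g(t)=|\{z\in D: |g(z)|>t\}|$. The Lorentz norm is $\|g\|_{L^{2,1}(D)}=2\int_0^\infty \mu_g(t)^{1/2}\,dt$ (for vector- or matrix-valued $g$, $|g|$ is the Euclidean norm). *)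

(* Defs.v *)
From HB Require Import structures.
From mathcomp Require Import all_boot all_order all_algebra.
From mathcomp Require Import all_classical all_reals all_analysis.

Set Implicit Arguments.
Unset Strict Implicit.
Unset Printing Implicit Defensive.

Import Order.TTheory GRing.Theory Num.Theory.
Import numFieldNormedType.Exports.

Local Open Scope classical_set_scope.
Local Open Scope ring_scope.

(* The plane is R * R; the norm that R * R carries in the library is the
   max-norm, so the disc and the Euclidean lengths are spelled out. *)

Definition disc (R : realType) : set (R * R) :=
  [set z | z.1 ^+ 2 + z.2 ^+ 2 < 1].

Definition cdisc (R : realType) : set (R * R) :=
  [set z | z.1 ^+ 2 + z.2 ^+ 2 <= 1].

Definition circle (R : realType) : set (R * R) :=
  [set z | z.1 ^+ 2 + z.2 ^+ 2 = 1].

Definition circle_pt (R : realType) (t : R) : R * R := (cos t, sin t).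

Definition angles (R : realType) : set R := `[0, 2 * pi[.

Definition leb2 (R : realType) := (@lebesgue_measure R \x @lebesgue_measure R)%E.

(* Arc length H^1 on the circle, computed in the angular coordinate. *)
Definition arc_length (R : realType) (A : set (R * R)) : \bar R :=
  lebesgue_measure (@angles R `&` [set t | A (circle_pt t)]).

Definition is_arc (R : realType) (A : set (R * R)) : Prop :=
  exists a b : R, a < b /\ A = @circle_pt R @` `]a, b[.

Definition union_of_arcs (R : realType) (E : set (R * R)) : Prop :=
  exists F : set (set (R * R)),
    (forall A, F A -> is_arc A) /\ E = \bigcup_(A in F) A.

Definition int_disc (R : realType) (f : R * R -> R) : R :=
  \int[@leb2 R]_(z in @disc R) f z.

Definition int_circle (R : realType) (h : R -> R) : R :=
  \int[@lebesgue_measure R]_(t in @angles R) h t.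

Definition L1_disc (R : realType) (f : R * R -> R) : Prop :=
  (@leb2 R).-integrable (@disc R) (fun z => (f z)%:E).

Definition L1_circle (R : realType) (w : R * R -> R) : Prop :=
  (@lebesgue_measure R).-integrable (@angles R) (fun t => (w (circle_pt t))%:E).

Definition d1 (R : realType) (f : R * R -> R) (z : R * R) : R :=
  'D_((1, 0) : R * R) f z.

Definition d2 (R : realType) (f : R * R -> R) (z : R * R) : R :=
  'D_((0, 1) : R * R) f z.

(* Counterclockwise tangential derivative at the point of angle t. *)
Definition dtau (R : realType) (f : R * R -> R) (t : R) : R :=
  derive1 (fun s : R => f (circle_pt s)) t.

(* C^k of the closed disc: every partial derivative of order at most k exists
   in the open disc and extends continuously to the closed disc; g1 and g2 are
   the extensions of the first-order ones. *)
Fixpoint Ck (R : realType) (k : nat) (f : R * R -> R) : Prop :=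
  {within @cdisc R, continuous f} /\
  (if k is k'.+1 then
     exists g1 g2 : R * R -> R,
       (forall z, @disc R z ->
          is_derive z ((1, 0) : R * R) f (g1 z) /\
          is_derive z ((0, 1) : R * R) f (g2 z)) /\
       Ck k' g1 /\ Ck k' g2
   else True).

Definition Cinfty (R : realType) (f : R * R -> R) : Prop :=
  forall k, Ck k f.

Definition test_disc (R : realType) (phi : R * R -> R) : Prop :=
  Cinfty phi /\
  exists K : set (R * R),
    [/\ compact K, K `<=` @disc R & forall z, ~ K z -> phi z = 0].

(* u belongs to W^{1,1}(D) and Du is its weak gradient. *)
Definition W11_grad (R : realType) (u : R * R -> R) (Du : R * R -> R * R)
    : Prop :=
  [/\ L1_disc u,
      L1_disc (fun z => (Du z).1),
      L1_disc (fun z => (Du z).2)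
    & forall phi, test_disc phi ->
        int_disc (fun z => u z * d1 phi z) =
          - int_disc (fun z => (Du z).1 * phi z) /\
        int_disc (fun z => u z * d2 phi z) =
          - int_disc (fun z => (Du z).2 * phi z)].

(* w is the trace of u: the trace operator is the continuous extension to
   W^{1,1}(D) of the restriction map from C^1 of the closed disc to the
   circle, with values in L^1 of the circle. *)
Definition is_trace (R : realType) (u : R * R -> R) (Du : R * R -> R * R)
    (w : R * R -> R) : Prop :=
  L1_circle w /\
  exists phi : nat -> R * R -> R,
    [/\ forall k, Ck 1 (phi k),
        (\int[@leb2 R]_(z in @disc R) `|phi k z - u z|%:E)%E
          @[k --> \oo] --> 0%E,
        (\int[@leb2 R]_(z in @disc R)
           (`|d1 (phi k) z - (Du z).1| + `|d2 (phi k) z - (Du z).2|)%:E)%E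
          @[k --> \oo] --> 0%E
      & (\int[@lebesgue_measure R]_(t in @angles R)
           `|phi k (circle_pt t) - w (circle_pt t)|%:E)%E
          @[k --> \oo] --> 0%E].

(* Weak solutions u, with weak gradient Du, of
     - Laplacian u = f                       in D,
     alpha du/dnu + beta du/dtau + gamma u = 0   on E,
     u = 0                                   on the rest of the circle. *)
Definition weak_solution (R : realType) (alpha beta gamma : R)
    (E : set (R * R)) (f u : R * R -> R) (Du : R * R -> R * R) : Prop :=
  W11_grad u Du /\
  exists w : R * R -> R,
    [/\ is_trace u Du w,
        {ae @lebesgue_measure R, forall t, @angles R t ->
           ~ E (circle_pt t) -> w (circle_pt t) = 0}
      & forall psi : R * R -> R, Ck 1 psi ->
          (forall z, @circle R z -> ~ E z -> psi z = 0) ->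
          alpha * int_disc (fun z =>
              (Du z).1 * d1 psi z + (Du z).2 * d2 psi z - f z * psi z)
          - beta * int_circle (fun t => w (circle_pt t) * dtau psi t)
          + gamma * int_circle (fun t => w (circle_pt t) * psi (circle_pt t))
          = 0].

(* Equal to +oo when Du is not square integrable. *)
Definition L2_norm (R : realType) (Du : R * R -> R * R) : \bar R :=
  ((\int[@leb2 R]_(z in @disc R) ((Du z).1 ^+ 2 + (Du z).2 ^+ 2)%:E)
     `^ 2^-1)%E.

Definition grad_norm (R : realType) (a b : R * R -> R) (z : R * R) : R :=
  Num.sqrt (d1 a z ^+ 2 + d2 a z ^+ 2 + d1 b z ^+ 2 + d2 b z ^+ 2).

Definition jac (R : realType) (a b : R * R -> R) (z : R * R) : R :=
  d1 a z * d2 b z - d2 a z * d1 b z.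

Definition distribution_fun (R : realType) (g : R * R -> R) (t : R) : \bar R :=
  @leb2 R (@disc R `&` [set z | t < `|g z|]).

Definition lorentz21 (R : realType) (g : R * R -> R) : \bar R :=
  (2%:E * \int[@lebesgue_measure R]_(t in `[0%R, +oo[)
            (distribution_fun g t `^ 2^-1))%E.

(* Main.v *)
Require Import Defs.
From HB Require Import structures.
From mathcomp Require Import all_boot all_order all_algebra.
From mathcomp Require Import all_classical all_reals all_analysis.
From mathcomp Require Import measurable_realfun.
From mathcomp Require Import ring lra.

(** Let p be a point of an open arc contained in E, let eps = 2^-n and let
    q = (1 + eps) p be a pole just outside the closed disc.  The n-th field is
    the holomorphic function V = eps / (z - q).  Its Jacobian |V'|^2, which is
    eps^2 / |z - q|^4, is nonnegative, has total mass of order 1 and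
    concentrates at p.  Since |grad V| = sqrt 2 eps / |z - q|^2 and
    |z - q| >= eps on the disc, the superlevel set at height t is contained
    in a ball whose area is of order eps / t and is empty when t exceeds
    sqrt 2 / eps; hence the Lorentz norms stay bounded ([lorentzV]).

    Points have zero capacity for the energy in the plane, and on E test
    functions are free to be large.  The weak formulation is tested with a
    function psi that looks like log (rho^2 / |z - q|^2) close to p and is
    supported in a small ball around q, so that it vanishes on the circle
    outside of E.  Then int det (grad V) psi grows like n ([int_Fpsi]), while
    int |grad psi|^2 grows only like n: each of the n dyadic annuli between
    the scales 1 and eps contributes a bounded amount ([int_sqdistV]).

    There remain the two boundary terms.  The function psi is defined as the
    angular derivative of a function H, namely H = T theta (log ...) where T
    is the tangential coordinate at p.  On the circle psi is thus the
    tangential derivative of H, and both boundary terms are integrals of the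
    trace of u against the tangential derivative of a C^2 function G equal to
    psi or to H.  By Green's theorem such an integral is the integral over
    the disc of Du.1 d2 G - Du.2 d1 G ([trace_green]).  The components of
    grad psi and grad H are at most 1000 / |z - q|, so the inequality
    2 |f g| <= mu f^2 + g^2 / mu ([amgm_int]) turns the weak formulation into

      c n - C <= K (mu int |Du|^2 + C' n / mu)

    with constants that depend neither on n nor on the solution
    ([energy_bound]).  With mu large enough the last term is half of c n, and
    int |Du|^2 tends to infinity. *)

Set Implicit Arguments.
Unset Strict Implicit.
Unset Printing Implicit Defensive.

Import Order.TTheory GRing.Theory Num.Theory.
Import numFieldNormedType.Exports.

Local Open Scope classical_set_scope.
Local Open Scope ring_scope.

(** * Gradients and classes of differentiable functions on a plane set *)

Section Gradient.
Context {R : realType}.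
Implicit Types (f g : R * R -> R) (z : R * R) (U : set (R * R)).

(** Frechet differentiability is required, and not only the existence of the two
    partial derivatives, so that the chain rule holds along the circle. *)
Definition isgrad f z (a b : R) : Prop :=
  is_diff z f (fun v : R * R => a * v.1 + b * v.2).

Lemma isgrad_eq f z a b c d :
  isgrad f z a b -> a = c -> b = d -> isgrad f z c d.
Proof. by move=> ? <- <-. Qed.

Lemma isgrad_continuous f z a b : isgrad f z a b -> {for z, continuous f}.
Proof. by rewrite /isgrad => fz; apply: differentiable_continuous; exact: ex_diff. Qed.

Lemma isgrad_cst c z : isgrad (fun=> c) z 0 0.
Proof.
apply: is_diff_eq.
by apply/funext => v /=; rewrite !mul0r addr0.
Qed.

Lemma isgrad_fst z : isgrad fst z 1 0.
Proof.
have c : continuous (fst : R * R -> R) by move=> x; exact: cvg_fst.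
have l : is_diff z (fst : R * R -> R) (fst : R * R -> R).
  by apply: DiffDef; [exact: linear_differentiable|exact: diff_lin].
apply: (is_diff_eq l).
by apply/funext => v /=; rewrite mul1r mul0r addr0.
Qed.

Lemma isgrad_snd z : isgrad snd z 0 1.
Proof.
have c : continuous (snd : R * R -> R) by move=> x; exact: cvg_snd.
have l : is_diff z (snd : R * R -> R) (snd : R * R -> R).
  by apply: DiffDef; [exact: linear_differentiable|exact: diff_lin].
apply: (is_diff_eq l).
by apply/funext => v /=; rewrite mul1r mul0r add0r.
Qed.

Lemma isgradD f g z a b c d : isgrad f z a b -> isgrad g z c d ->
  isgrad (fun x => f x + g x) z (a + c) (b + d).
Proof.
rewrite /isgrad => fz gz; apply: is_diff_eq.
by apply/funext => v; rewrite fctE; ring.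
Qed.

Lemma isgradM f g z a b c d : isgrad f z a b -> isgrad g z c d ->
  isgrad (fun x => f x * g x) z (a * g z + f z * c) (b * g z + f z * d).
Proof.
rewrite /isgrad => fz gz; apply: is_diff_eq.
by apply/funext => v; rewrite !fctE /= /GRing.scale /=; ring.
Qed.

Lemma isgrad_comp (h : R -> R) f z a b c : isgrad f z a b ->
  is_derive (f z) 1 h c -> isgrad (fun x => h (f x)) z (c * a) (c * b).
Proof.
move=> fz hfz.
have dh : is_diff (f z) h (fun x => x * c).
  apply: DiffDef; first by apply/derivable1_diffP; exact: ex_derive.
  by rewrite diff1E ?derive1E ?derive_val//; apply/derivable1_diffP; exact: ex_derive.
apply: (is_diff_eq (is_diff_comp fz dh)).
by apply/funext => v /=; ring.
Qed.

Lemma isgrad_is_derive f z a b : isgrad f z a b ->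
  is_derive z ((1, 0) : R * R) f a /\ is_derive z ((0, 1) : R * R) f b.
Proof.
rewrite /isgrad => fz; have df : differentiable f z by exact: ex_diff.
by split; apply: DeriveDef; (try exact: diff_derivable); rewrite deriveE// diff_val/=; ring.
Qed.

Lemma isgrad_d1 f z a b : isgrad f z a b -> d1 f z = a.
Proof. by case/isgrad_is_derive => + _ => ?; rewrite /d1 derive_val. Qed.

Lemma isgrad_d2 f z a b : isgrad f z a b -> d2 f z = b.
Proof. by case/isgrad_is_derive => _ + => ?; rewrite /d2 derive_val. Qed.

Lemma isgrad_circle f t a b : isgrad f (circle_pt t) a b ->
  is_derive t 1 (fun s => f (circle_pt s)) (- (a * sin t) + b * cos t).
Proof.
rewrite /isgrad => fz.
have toDiff (h : R -> R) c : is_derive t 1 h c -> is_diff t h (fun x => x * c).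
  move=> hfz; apply: DiffDef; first by apply/derivable1_diffP; exact: ex_derive.
  by rewrite diff1E ?derive1E ?derive_val//; apply/derivable1_diffP; exact: ex_derive.
have dcos := toDiff _ _ (is_derive_cos t).
have dsin := toDiff _ _ (is_derive_sin t).
have dcirc := is_diff_pair dcos dsin.
have dc := is_diff_comp dcirc fz.
have df : differentiable (f \o (fun y : R => (cos y, sin y))) t by exact: ex_diff.
split; first by apply/derivable1_diffP.
by rewrite deriveE// diff_val/=; ring.
Qed.

(** Like [Ck], but with Frechet derivatives and on an arbitrary set: the fields
    and test functions below are smooth on the complement of the pole, so no
    boundary extension has to be constructed. *)
Fixpoint Ckon U (k : nat) f : Prop :=
  (forall z, U z -> {for z, continuous f}) /\
  (if k is k'.+1 then exists g1 g2 : R * R -> R,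
     (forall z, U z -> isgrad f z (g1 z) (g2 z)) /\ Ckon U k' g1 /\ Ckon U k' g2
   else True).

Lemma CkonS U k f : Ckon U k.+1 f -> Ckon U k f.
Proof.
elim: k f => [f [cf _]//|k IH f [cf [g1 [g2 [fg [cg1 cg2]]]]]].
split => //; exists g1, g2; split => //; split; exact: IH.
Qed.

Lemma Ckon_Ck U k f : @cdisc R `<=` U -> Ckon U k f -> Ck k f.
Proof.
move=> DU; elim: k f => [f [cf _]|k IH f [cf [g1 [g2 [fg [cg1 cg2]]]]]].
  split => //; apply: continuous_in_subspaceT => z /set_mem/DU; exact: cf.
split; first by apply: continuous_in_subspaceT => z /set_mem/DU; exact: cf.
exists g1, g2; split; last by split; exact: IH.
move=> z Dz; apply: isgrad_is_derive; apply/fg/DU.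
by rewrite /cdisc/=; apply: ltW.
Qed.

Lemma Ckon_cst U k c : Ckon U k (fun=> c).
Proof.
elim: k c => [|k IH] c; (split; first by move=> z _; exact: cvg_cst); first exact: I.
by exists (fun=> 0), (fun=> 0); split => // z _; exact: isgrad_cst.
Qed.

Lemma Ckon_fst U k : Ckon U k fst.
Proof.
have c : forall z : R * R, U z -> {for z, continuous (fst : R * R -> R)}.
  by move=> z _; exact: cvg_fst.
case: k => [|k]; split; [exact: c|exact: I|exact: c|].
exists (fun=> 1), (fun=> 0); split; first by move=> z _; exact: isgrad_fst.
by split; exact: Ckon_cst.
Qed.

Lemma Ckon_snd U k : Ckon U k snd.
Proof.
have c : forall z : R * R, U z -> {for z, continuous (snd : R * R -> R)}.
  by move=> z _; exact: cvg_snd.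
case: k => [|k]; split; [exact: c|exact: I|exact: c|].
exists (fun=> 0), (fun=> 1); split; first by move=> z _; exact: isgrad_snd.
by split; exact: Ckon_cst.
Qed.

Lemma CkonD U k f g : Ckon U k f -> Ckon U k g -> Ckon U k (fun z => f z + g z).
Proof.
elim: k f g => [|k IH] f g [cf ef] [cg eg].
  by split => // z Uz; apply: cvgD; [exact: cf|exact: cg].
split; first by move=> z Uz; apply: cvgD; [exact: cf|exact: cg].
case: ef eg => f1 [f2 [df [cf1 cf2]]] [g1 [g2 [dg [cg1 cg2]]]].
exists (fun z => f1 z + g1 z), (fun z => f2 z + g2 z); split; last by split; exact: IH.
by move=> z Uz; apply: isgradD; [exact: df|exact: dg].
Qed.

Lemma CkonM U k f g : Ckon U k f -> Ckon U k g -> Ckon U k (fun z => f z * g z).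
Proof.
elim: k f g => [|k IH] f g cf0 cg0; move: (cf0) (cg0) => [cf ef] [cg eg].
  by split => // z Uz; apply: cvgM; [exact: cf|exact: cg].
split; first by move=> z Uz; apply: cvgM; [exact: cf|exact: cg].
case: ef eg => f1 [f2 [df [cf1 cf2]]] [g1 [g2 [dg [cg1 cg2]]]].
exists (fun z => f1 z * g z + f z * g1 z), (fun z => f2 z * g z + f z * g2 z).
split; last first.
  by split; apply: CkonD; apply: IH => //; exact: CkonS.
by move=> z Uz; apply: isgradM; [exact: df|exact: dg].
Qed.

Lemma CkonV U k f : (forall z, U z -> f z != 0) -> Ckon U k f ->
  Ckon U k (fun z => (f z)^-1).
Proof.
move=> f0; elim: k => [|k IH] cf0; move: (cf0) => [cf ef].
  by split => // z Uz; apply: cvgV; [exact: f0|exact: cf].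
split; first by move=> z Uz; apply: cvgV; [exact: f0|exact: cf].
case: ef => f1 [f2 [df [cf1 cf2]]].
have cV := IH (CkonS cf0).
exists (fun z => - 1 * ((f z)^-1 * (f z)^-1) * f1 z),
   (fun z => - 1 * ((f z)^-1 * (f z)^-1) * f2 z).
split; last first.
  by split; do 2!(apply: CkonM => //); try exact: Ckon_cst; exact: CkonM.
move=> z Uz; apply: isgrad_comp; first exact: df.
apply: is_derive_eq; first by apply: is_deriveV; exact: f0.
by rewrite /GRing.scale/= expr2 invfM; ring.
Qed.

(** A single function h12 represents both mixed second derivatives: their
    equality, which Green's identity below requires, is carried along by the
    closure properties. *)
Definition C2on U f : Prop := exists g1 g2 h11 h12 h22 : R * R -> R,
  [/\ forall z, U z -> isgrad f z (g1 z) (g2 z),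
      forall z, U z -> isgrad g1 z (h11 z) (h12 z),
      forall z, U z -> isgrad g2 z (h12 z) (h22 z) &
      forall z, U z -> [/\ {for z, continuous h11}, {for z, continuous h12}
                         & {for z, continuous h22}]].

Lemma C2on_Ckon U f : C2on U f -> Ckon U 2 f.
Proof.
move=> [g1 [g2 [h11 [h12 [h22 [fg g1h g2h ch]]]]]].
split; first by move=> z Uz; exact: isgrad_continuous (fg _ Uz).
exists g1, g2; split => //; split; split.
- by move=> z Uz; exact: isgrad_continuous (g1h _ Uz).
- by exists h11, h12; split => //; split; split => // z /ch[].
- by move=> z Uz; exact: isgrad_continuous (g2h _ Uz).
- by exists h12, h22; split => //; split; split => // z /ch[].
Qed.

Lemma C2on_cst U c : C2on U (fun=> c).
Proof.
exists (fun=> 0), (fun=> 0), (fun=> 0), (fun=> 0), (fun=> 0).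
by split => z _; try exact: isgrad_cst; split; exact: cvg_cst.
Qed.

Lemma C2on_fst U : C2on U fst.
Proof.
exists (fun=> 1), (fun=> 0), (fun=> 0), (fun=> 0), (fun=> 0).
split => z _; try exact: isgrad_cst; first exact: isgrad_fst.
by split; exact: cvg_cst.
Qed.

Lemma C2on_snd U : C2on U snd.
Proof.
exists (fun=> 0), (fun=> 1), (fun=> 0), (fun=> 0), (fun=> 0).
split => z _; try exact: isgrad_cst; first exact: isgrad_snd.
by split; exact: cvg_cst.
Qed.

Lemma C2onD U f g : C2on U f -> C2on U g -> C2on U (fun z => f z + g z).
Proof.
move=> [a1 [a2 [b11 [b12 [b22 [fa a1b a2b cb]]]]]].
move=> [g1 [g2 [h11 [h12 [h22 [gg g1h g2h ch]]]]]].
exists (fun z => a1 z + g1 z), (fun z => a2 z + g2 z), (fun z => b11 z + h11 z),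
  (fun z => b12 z + h12 z), (fun z => b22 z + h22 z).
split => z Uz; try by apply: isgradD; auto.
by case: (cb z Uz) => ? ? ?; case: (ch z Uz) => ? ? ?; split; apply: cvgD.
Qed.

Lemma C2onM U f g : C2on U f -> C2on U g -> C2on U (fun z => f z * g z).
Proof.
move=> [a1 [a2 [b11 [b12 [b22 [fa a1b a2b cb]]]]]].
move=> [g1 [g2 [h11 [h12 [h22 [gg g1h g2h ch]]]]]].
exists (fun z => a1 z * g z + f z * g1 z), (fun z => a2 z * g z + f z * g2 z),
  (fun z => (b11 z * g z + a1 z * g1 z) + (a1 z * g1 z + f z * h11 z)),
  (fun z => (b12 z * g z + a1 z * g2 z) + (a2 z * g1 z + f z * h12 z)),
  (fun z => (b22 z * g z + a2 z * g2 z) + (a2 z * g2 z + f z * h22 z)).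
split => z Uz.
- by apply: isgradM; auto.
- by apply: isgradD; apply: isgradM; auto.
- apply: isgrad_eq.
  + by apply: isgradD; apply: isgradM; auto.
  + by ring.
  + by [].
- have [? ? ?] := cb z Uz; have [? ? ?] := ch z Uz.
  have ? := isgrad_continuous (fa z Uz).
  have ? := isgrad_continuous (gg z Uz).
  have ? := isgrad_continuous (a1b z Uz).
  have ? := isgrad_continuous (a2b z Uz).
  have ? := isgrad_continuous (g1h z Uz).
  have ? := isgrad_continuous (g2h z Uz).
  by split; apply: cvgD; apply: cvgD; apply: cvgM.
Qed.

Lemma C2on_comp U (V : set R) (h h1 h2 : R -> R) f : C2on U f ->
  (forall z, U z -> V (f z)) ->
  (forall s, V s -> is_derive s 1 h (h1 s)) ->
  (forall s, V s -> is_derive s 1 h1 (h2 s)) ->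
  (forall s, V s -> {for s, continuous h2}) ->
  C2on U (fun z => h (f z)).
Proof.
move=> [g1 [g2 [b11 [b12 [b22 [fg g1h g2h cb]]]]]] UV dh dh1 ch2.
exists (fun z => h1 (f z) * g1 z), (fun z => h1 (f z) * g2 z),
 (fun z => h2 (f z) * g1 z * g1 z + h1 (f z) * b11 z),
 (fun z => h2 (f z) * g2 z * g1 z + h1 (f z) * b12 z),
 (fun z => h2 (f z) * g2 z * g2 z + h1 (f z) * b22 z).
have dc z : U z -> isgrad (fun z => h1 (f z)) z (h2 (f z) * g1 z) (h2 (f z) * g2 z).
  by move=> Uz; apply: isgrad_comp; auto.
split => z Uz.
- by apply: isgrad_comp; auto.
- by apply: isgradM; auto.
- apply: isgrad_eq.
  + by apply: isgradM; auto.
  + by rewrite /=; ring.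
  + by [].
- have [? ? ?] := cb z Uz.
  have ? := isgrad_continuous (fg z Uz).
  have ? := isgrad_continuous (g1h z Uz).
  have ? := isgrad_continuous (g2h z Uz).
  have ? := isgrad_continuous (dc z Uz).
  have ch : {for z, continuous (fun z => h2 (f z))}.
    by apply: (@continuous_comp _ _ _ f h2) => //; apply/ch2/UV.
  by split; (apply: cvgD; [do 2!(apply: cvgM => //)|apply: cvgM => //]).
Qed.

End Gradient.

(** * Smooth truncations of the line *)

Section OneVar.
Context {R : realType}.
Implicit Types s : R.

(** A power of the positive part of s, damped at infinity.  The function
    [ramp 5 2] is of class C^4, vanishes for s <= 0 and is comparable with s
    for s >= 1: it is the cut-off used for the test function. *)
Definition ramp (a b : nat) s : R := Num.max s 0 ^+ a * (1 + s ^+ 2)^-1 ^+ b.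

Lemma onesq_gt0 s : 0 < 1 + s ^+ 2.
Proof. by rewrite ltr_pwDl// sqr_ge0. Qed.

Lemma pospart_continuous : continuous (fun s => Num.max s 0).
Proof.
by move=> s; apply: (@continuous_max _ _ (@idfun R) (cst 0)); [exact: cvg_id|exact: cvg_cst].
Qed.

Lemma is_derive_pospart a s :
  is_derive s 1 (fun t => Num.max t 0 ^+ a.+2) (a.+2%:R * Num.max s 0 ^+ a.+1).
Proof.
have [s0|s0|->] := ltgtP s 0.
- rewrite [X in _ * X]exprS mul0r mulr0.
  apply: (@near_eq_is_derive _ _ _ (cst (0:R))).
  near=> t; rewrite /= max_r ?exprS ?mul0r//; apply/ltW.
  by near: t; exact: lt_nbhsl.
- have ds : is_derive s 1 (@idfun R ^+ a.+2) (a.+2%:R * s ^+ a.+1).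
    by apply: is_derive_eq; rewrite /GRing.scale/= mulr1.
  apply: near_eq_is_derive ds.
  near=> t; rewrite /= max_l// ?fctE//; apply/ltW.
  by near: t; exact: lt_nbhsr.
rewrite [X in _ * X]exprS mul0r mulr0.
(* At 0 the difference quotient is a lower power of the positive part. *)
have H : (fun h : R => h^-1 *: (((fun t => Num.max t 0 ^+ a.+2) \o shift (0:R)) (h *: (1 : R))
   - Num.max 0 0 ^+ a.+2)) @ 0^' --> (0 : R).
  apply: (@cvg_trans _ ((fun h : R => Num.max h 0 ^+ a.+1) @ 0^')).
    apply: near_eq_cvg; near=> h.
    have h0 : h != 0 by near: h; exact: nbhs_dnbhs_neq.
    rewrite /= /GRing.scale/= mulr1 addr0 maxxx [X in _ - X]exprS mul0r subr0.
    have [hn|hp|/eqP] := ltgtP h 0; last by rewrite (negbTE h0).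
      by rewrite !exprS !mul0r mulr0.
    by rewrite [in RHS]exprS mulrA mulVf// mul1r.
  have c0 : {for (0:R), continuous (fun h : R => Num.max h 0 ^+ a.+1)}.
    by apply: (@continuous_comp _ _ _ (fun s : R => Num.max s 0) (fun s => s ^+ a.+1));
      [exact: pospart_continuous|exact: exprn_continuous].
  move/continuous_withinNx : c0.
  by rewrite /= maxxx [X in _ --> X]exprS mul0r.
apply: DeriveDef; first by apply/cvg_ex; exists 0.
exact: cvg_lim H.
Unshelve. all: by end_near.
Qed.

(** The family is stable under differentiation because s max(s, 0)^(a+2) is
    max(s, 0)^(a+3). *)
Lemma is_derive_ramp a b s : is_derive s 1 (ramp a.+2 b)
   (a.+2%:R * ramp a.+1 b s - 2 * b%:R * ramp a.+3 b.+1 s).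
Proof.
have s1 := onesq_gt0 s.
have d0 : is_derive s 1 (cst 1 + (@idfun R) ^+ 2) (2 * s).
  apply: (is_derive_eq (is_deriveD (is_derive_cst (1 : R) s (1 : R))
    (is_deriveX 2 (is_derive_id s (1 : R))))).
  by rewrite /GRing.scale/= expr1 mulr1 add0r.
have n0 : (cst 1 + (@idfun R) ^+ 2) s != 0 by rewrite !fctE gt_eqF.
have dV : is_derive s 1 (fun t => (1 + t ^+ 2)^-1 : R) (- (2 * s) * (1 + s ^+ 2)^-1 ^+ 2).
  apply: (is_derive_eq (is_deriveV n0 d0)).
  by rewrite !fctE /GRing.scale /= exprVn; ring.
have dw := is_deriveX b dV.
have -> : ramp a.+2 b = (fun t => Num.max t 0 ^+ a.+2) * (fun t => (1 + t ^+ 2)^-1) ^+ b.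
  by apply/funext => t; rewrite /ramp !fctE.
apply: (is_derive_eq (is_deriveM (is_derive_pospart a s) dw)).
rewrite /ramp /GRing.scale/= !fctE.
case: b {dw} => [|b]; first by rewrite !expr0; ring.
have sm : s * Num.max s 0 ^+ a.+2 = Num.max s 0 ^+ a.+3.
  rewrite [RHS]exprS; have [?|?] := leP s 0; last by [].
  by rewrite exprS mul0r !mulr0.
by rewrite -sm /= !exprS; ring.
Qed.

Lemma ramp_continuous a b : continuous (ramp a b).
Proof.
move=> s; apply: cvgM.
  by apply: (@continuous_comp _ _ _ (fun s => Num.max s 0) (fun s => s ^+ a));
   [exact: pospart_continuous|exact: exprn_continuous].
apply: (@continuous_comp _ _ _ (fun s : R => (1 + s ^+ 2)^-1) (fun s => s ^+ b));
  last exact: exprn_continuous.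
apply: cvgV; first by rewrite gt_eqF// onesq_gt0.
by apply: cvgD; [exact: cvg_cst|exact: exprn_continuous].
Qed.

Lemma ramp_ge0 a b s : 0 <= ramp a b s.
Proof.
rewrite mulr_ge0// exprn_ge0//; first by rewrite le_max lexx orbT.
by rewrite invr_ge0 ltW// onesq_gt0.
Qed.

(** Split at max(s, 0) = 1: below, the numerator is at most 1; above, it is at
    most (s^2)^b. *)
Lemma ramp_le1 a b s : (a <= b.*2)%N -> ramp a b s <= 1.
Proof.
move=> ab; have s1 := onesq_gt0 s.
rewrite /ramp exprVn ler_pdivrMr ?exprn_gt0// mul1r.
set m := Num.max s 0.
have m0 : 0 <= m by rewrite le_max lexx orbT.
have ms : m ^+ 2 <= s ^+ 2.
  by rewrite /m; have [?|?] := leP s 0; rewrite ?expr0n ?sqr_ge0.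
have [m1|m1] := leP m 1.
  apply: (@le_trans _ _ 1); first by rewrite exprn_ile1.
  by rewrite exprn_ege1// lerDl sqr_ge0.
apply: (@le_trans _ _ (m ^+ b.*2)); first by rewrite ler_weXn2l// ltW.
rewrite -mul2n exprM lerXn2r// ?nnegrE ?sqr_ge0 ?(ltW s1)//.
by apply: (le_trans ms); rewrite lerDr.
Qed.

Lemma ramp0 a b s : s <= 0 -> ramp a.+1 b s = 0.
Proof. by move=> s0; rewrite /ramp max_r// exprS mul0r mul0r. Qed.

Lemma ramp52_le s : ramp 5 2 s <= Num.max s 0.
Proof.
rewrite {1}/ramp exprS -mulrA; have m0 : 0 <= Num.max s 0 by rewrite le_max lexx orbT.
by rewrite -[leRHS]mulr1 ler_wpM2l//; exact: (@ramp_le1 4 2).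
Qed.

Lemma ramp52_ge s : 1 <= s -> s / 4 <= ramp 5 2 s.
Proof.
move=> s1; have p := onesq_gt0 s; have s0 : 0 < s by lra.
rewrite /ramp max_l ?(ltW s0)// exprVn ler_pdivlMr ?exprn_gt0//.
rewrite mulrAC ler_pdivrMr//.
have -> : s ^+ 5 * 4 = s * (2 * s ^+ 2) ^+ 2 by ring.
rewrite ler_pM2l//.
have s2 : 1 <= s ^+ 2 by exact: exprn_ege1.
by apply: lerXn2r; rewrite ?nnegrE; lra.
Qed.

(** From s = exp (ln s) >= 1 + (ln s)^2 / 2. *)
Lemma ln_sqr_le s : 0 < s -> Num.max (ln s) 0 ^+ 2 <= 2 * s.
Proof.
move=> s0; have [ls|ls] := leP (ln s) 0.
  by rewrite expr0n/= mulr_ge0// ltW.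
have : expR (ln s) = s by rewrite lnK// posrE.
have := expR_ge1Dxn 1 (ltW ls).
have -> : (2`!)%:R = 2 :> R by [].
by move=> /[swap] ->; lra.
Qed.

Lemma C2on_ramp U (f : R * R -> R) a b : C2on U f -> C2on U (fun z => ramp a.+3 b (f z)).
Proof.
move=> Uf; pose h1 s := a.+3%:R * ramp a.+2 b s - 2 * b%:R * ramp a.+4 b.+1 s.
pose h2 s := a.+3%:R * (a.+2%:R * ramp a.+1 b s - 2 * b%:R * ramp a.+3 b.+1 s)
   - 2 * b%:R * (a.+4%:R * ramp a.+3 b.+1 s - 2 * b.+1%:R * ramp a.+4.+1 b.+2 s).
apply: (@C2on_comp _ _ setT _ h1 h2); [exact: Uf|by []|..] => s _.
- exact: is_derive_ramp.
- have -> : h1 = a.+3%:R \*: ramp a.+2 b - (2 * b%:R) \*: ramp a.+4 b.+1 by [].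
  apply: is_deriveB; apply: is_deriveZ; exact: is_derive_ramp.
- apply: cvgB; (apply: cvgM; [exact: cvg_cst|]); apply: cvgB;
   (apply: cvgM; [exact: cvg_cst|]); exact: ramp_continuous.
Qed.

Lemma C2on_inv U (f : R * R -> R) : (forall z, U z -> 0 < f z) -> C2on U f ->
  C2on U (fun z => (f z)^-1).
Proof.
move=> f0 Uf; apply: (@C2on_comp _ _ [set s | 0 < s] (fun s => s^-1) (fun s => - s ^- 2)
   (fun s => 2 * s ^- 3)); [exact: Uf|exact: f0|..] => s s0.
- apply: is_derive_eq; first by apply: is_deriveV; rewrite gt_eqF.
  by rewrite /GRing.scale/= mulr1.
- have d2 : is_derive s 1 ((@idfun R) ^+ 2) (2 * s).
    by apply: is_derive_eq; rewrite /GRing.scale/= expr1 mulr1.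
  have n2 : ((@idfun R) ^+ 2) s != 0 by rewrite !fctE expf_neq0// gt_eqF.
  apply: (is_derive_eq (is_deriveN (is_deriveV n2 d2))).
  rewrite !fctE /GRing.scale/=; field; by rewrite gt_eqF.
- apply: cvgM; first exact: cvg_cst.
  apply: cvgV; first by rewrite expf_neq0// gt_eqF.
  exact: exprn_continuous.
Qed.

Lemma C2on_ln U (f : R * R -> R) : (forall z, U z -> 0 < f z) -> C2on U f ->
  C2on U (fun z => ln (f z)).
Proof.
move=> f0 Uf; apply: (@C2on_comp _ _ [set s | 0 < s] (@ln R) (fun s => s^-1)
   (fun s => - s ^- 2)); [exact: Uf|exact: f0|..] => s s0.
- apply: is_derive_eq; first by apply: is_deriveV; rewrite gt_eqF.
  by rewrite /GRing.scale/= mulr1.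
- apply: cvgN; apply: cvgV; first by rewrite expf_neq0// gt_eqF.
  exact: exprn_continuous.
Qed.

End OneVar.

(** * Measurability and integrability on the disc *)

(** The display carried by [leb2]; the type R * R alone would elaborate to
    another one, with the same measurable sets. *)
Notation measurable2 := (@measurable _ (measurableTypeR _ * measurableTypeR _)%type).
Notation measurable_fun2 := (@measurable_fun _ _ (measurableTypeR _ * measurableTypeR _)%type _).
Section Meas.
Context {R : realType}.
Implicit Types (f g : R * R -> R) (z : R * R).

(** An open set of the plane is the union of the countably many open squares with
    rational center and inverse integer half-side that it contains. *)
Lemma open_measurable2 (U : set (R * R)) : open U -> measurable2 U.
Proof.
move=> oU.
pose F (k : nat) : set (R * R) :=
  if @unpickle (rat * rat * nat)%type k is Some (a, b, n) then
    let Q := `](ratr a - n.+1%:R^-1), (ratr a + n.+1%:R^-1)[%classic `*`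
             `](ratr b - n.+1%:R^-1), (ratr b + n.+1%:R^-1)[%classic in
    if pselect (Q `<=` U) is left _ then Q else set0
  else set0.
have -> : U = \bigcup_k F k.
  apply/seteqP; split => [z Uz|z [k _]]; last first.
    rewrite /F; case: unpickle => // -[[a b] n]; case: pselect => // QU Qz.
    exact: QU.
  have /nbhs_ballP[e /= e0 eU] : nbhs z U by exact: open_nbhs_nbhs.
  have [n] : exists n : nat, 0 + n.+1%:R^-1 < e / 2.
    by apply: ltr_add_invr; rewrite divr_gt0.
  have : 0 < n.+1%:R^-1 :> R by rewrite invr_gt0.
  rewrite add0r; set d : R := n.+1%:R^-1 => n0 ne.
  have h1 : z.1 - d < z.1 + d by lra.
  have [a] := rat_in_itvoo h1.
  rewrite in_itv/= => /andP[a1 a2].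
  have h2 : z.2 - d < z.2 + d by lra.
  have [b] := rat_in_itvoo h2.
  rewrite in_itv/= => /andP[b1 b2].
  exists (pickle (a, b, n)); [by []|]; rewrite /F pickleK -/d.
  case: pselect => [_|[]].
    by split; rewrite /= in_itv/=; apply/andP; split; lra.
  move=> w [/=]; rewrite !in_itv/= => /andP[? ?] /andP[? ?]; apply: eU.
  by split => /=; rewrite /ball/= ltr_norml; apply/andP; split; lra.
apply: bigcupT_measurable => k; rewrite /F.
case: unpickle => [[[a b] n]|]; last exact: measurable0.
case: pselect => _; last exact: measurable0.
by apply: measurableX; exact: measurable_itv.
Qed.

Lemma wcont_measurable (D : set (R * R)) f :
  measurable2 D -> {within D, continuous f} -> measurable_fun2 D f.
Proof.
move=> mD /continuousP cf; apply: (measurability _ (RGenOpens.measurableE R)).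
move=> _ [_ [a [b ->] <-]].
have /open_subspaceP[V oV VD] := cf _ (@interval_open _ (BRight a) (BLeft b) isT isT).
rewrite setIC -VD; apply: measurableI => //; exact: open_measurable2.
Qed.

Lemma normsq_continuous : continuous (fun z : R * R => z.1 ^+ 2 + z.2 ^+ 2).
Proof.
move=> z; apply: cvgD; rewrite !expr2.
  by apply: (@cvgM _ _ _ _ (fun z => z.1) (fun z => z.1)); exact: cvg_fst.
by apply: (@cvgM _ _ _ _ (fun z => z.2) (fun z => z.2)); exact: cvg_snd.
Qed.

Lemma disc_open : open (@disc R).
Proof.
have -> : @disc R = (fun z : R * R => z.1 ^+ 2 + z.2 ^+ 2) @^-1` [set x | x < 1] by [].
by apply: open_comp => //; move=> z _; exact: normsq_continuous.
Qed.

Lemma cdisc_closed : closed (@cdisc R).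
Proof.
have -> : @cdisc R = (fun z : R * R => z.1 ^+ 2 + z.2 ^+ 2) @^-1` [set x | x <= 1] by [].
by apply: closed_comp => //; move=> z _; exact: normsq_continuous.
Qed.

Lemma measurable_disc : measurable2 (@disc R).
Proof. by apply: open_measurable2; exact: disc_open. Qed.

Lemma sqr_le1 (x y : R) : x ^+ 2 + y ^+ 2 <= 1 -> -1 <= x <= 1.
Proof. by move=> h; have := sqr_ge0 y; nra. Qed.

Lemma cdisc_compact : compact (@cdisc R).
Proof.
have cs : compact (`[-1, 1]%classic : set R) by exact: segment_compact.
apply: (subclosed_compact cdisc_closed (compact_setX cs cs)).
move=> [x y]; rewrite /cdisc/= => h; split; rewrite /= in_itv/=.
  exact: sqr_le1 h.
by rewrite addrC in h; exact: sqr_le1 h.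
Qed.

Lemma disc_cdisc : @disc R `<=` @cdisc R.
Proof. by move=> z; rewrite /disc/cdisc/=; exact: ltW. Qed.

Lemma leb2_square (a b r : R) : 0 <= r ->
  leb2 (`[(a - r), (a + r)]%classic `*` `[(b - r), (b + r)]%classic) = (4 * r ^+ 2)%:E.
Proof.
move=> r0.
have lebI (c : R) : (@lebesgue_measure R) `[(c - r), (c + r)]%classic = (2 * r)%:E.
  rewrite lebesgue_measure_itv/= lte_fin.
  have -> : (c - r < c + r) = (0 < r) by apply/idP/idP; lra.
  by case: ltP => r1; [rewrite -EFinB; congr EFin; ring|congr EFin; lra].
rewrite /leb2 product_measure1E; [|exact: measurable_itv..].
transitivity ((2 * r)%:E * (2 * r)%:E)%E; first by congr (_ * _)%E; exact: lebI.
by rewrite -EFinM; congr EFin; ring.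
Qed.

Lemma leb2_disc_le : (leb2 (@disc R) <= 4%:E)%E.
Proof.
have -> : 4 = 4 * 1 ^+ 2 :> R by rewrite expr1n mulr1.
rewrite -(@leb2_square 0 0 1)//; apply: le_measure; rewrite ?inE.
- exact: measurable_disc.
- by apply: measurableX; exact: measurable_itv.
- move=> [x y]; rewrite /disc/= => /ltW h; rewrite !add0r; split; rewrite /= in_itv/=.
    exact: sqr_le1 h.
  by rewrite addrC in h; exact: sqr_le1 h.
Qed.

Lemma leb2_disc_fin : (leb2 (@disc R) < +oo)%E.
Proof. exact: le_lt_trans leb2_disc_le (ltry _). Qed.

Lemma wcont_bounded f : {within @cdisc R, continuous f} ->
  exists2 M, 0 <= M & forall z, @cdisc R z -> `|f z| <= M.
Proof.
move=> cf; have /compact_bounded[M [_ HM]] := continuous_compact cf cdisc_compact.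
exists (`|M| + 1); first by rewrite addr_ge0.
move=> z Dz; apply: HM; last by exists z.
by rewrite (le_lt_trans (ler_norm M))// ltrDl.
Qed.

Lemma wcont_measurable_disc f : {within @cdisc R, continuous f} ->
  measurable_fun2 (@disc R) f.
Proof.
move=> cf; apply: wcont_measurable; first exact: measurable_disc.
exact: continuous_subspaceW disc_cdisc cf.
Qed.

Lemma L1_bounded f (M : R) : measurable_fun2 (@disc R) f ->
  (forall z, @disc R z -> `|f z| <= M) -> L1_disc f.
Proof.
move=> mf fM; apply: measurable_bounded_integrable => //.
- exact: measurable_disc.
- exact: leb2_disc_fin.
- exists M; split; first exact: num_real.
  by move=> x Mx z Dz; apply: le_trans (fM _ Dz) (ltW Mx).
Qed.

Lemma L1_wcont f : {within @cdisc R, continuous f} -> L1_disc f.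
Proof.
move=> cf; have [M M0 fM] := wcont_bounded cf.
apply: (@L1_bounded _ M); first exact: wcont_measurable_disc.
by move=> z Dz; apply/fM/disc_cdisc.
Qed.

Lemma L1_mul f g : L1_disc f -> {within @cdisc R, continuous g} ->
  L1_disc (fun z => f z * g z).
Proof.
move=> f1 cg; have [M M0 gM] := wcont_bounded cg.
have /integrableP[/measurable_EFinP mf _] := f1.
apply: (le_integrable measurable_disc _ _ (integrableZl measurable_disc M f1)).
- apply/measurable_EFinP; apply: measurable_funM => //; exact: wcont_measurable_disc.
- move=> z Dz; rewrite -EFinM lee_fin !normrM (ger0_norm M0) mulrC ler_wpM2r//.
  exact/gM/disc_cdisc.
Qed.

End Meas.

(** * Continuity and change of variables on an interval *)

Section OneDim.
Context {R : realType}.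
Notation mu := (@lebesgue_measure R).
Notation itvint a b h := (\int[mu]_(t in `[a, b]) h t)%R.

Lemma within_comp (T S : topologicalType) (V : topologicalType) (A : set T) (B : set S)
   (c : T -> S) (P : S -> V) :
  {within A, continuous c} -> (forall s, A s -> B (c s)) ->
  {within B, continuous P} -> {within A, continuous (P \o c)}.
Proof.
move=> /subspace_continuousP cc AB /subspace_continuousP cP.
apply/subspace_continuousP => x Ax W /= PW.
have := cP _ (AB _ Ax) _ PW; rewrite /= !nbhs_simpl /= => H.
have H2 := cc _ Ax _ H.
move: H2; rewrite /= !nbhs_simpl /=; rewrite /within /= => H2.
near=> s => As; rewrite /=.
have : A s -> B (c s) -> W (P (c s)) by near: s.
by apply => //; exact: AB.
Unshelve. all: by end_near. Qed.

Lemma int_split (h : R -> R) (a c b : R) : a <= c -> c <= b ->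
  {within `[a, b], continuous h} -> itvint a b h = itvint a c h + itvint c b h.
Proof.
move=> ac cb ch.
have ih : mu.-integrable `[a, b] (EFin \o h).
  by apply: continuous_compact_integrable => //; exact: segment_compact.
rewrite -(@Rintegral_itv_obnd_cbnd _ c (BRight b)); last first.
  by apply: integrableS ih => //; apply: subset_itvr; rewrite bnd_simp.
by rewrite -(@Rintegral_itvB _ h (BLeft a) (BRight b) c) ?bnd_simp// addrC subrK.
Qed.

Lemma derivable_LR (F f : R -> R) (a b : R) : (forall t : R, is_derive t (1 : R) F (f t)) ->
  derivable_oo_LRcontinuous F a b.
Proof.
move=> dF; have cF : continuous F.
  by move=> x; apply/differentiable_continuous/derivable1_diffP; exact: ex_derive.
split; first by move=> x _; exact: ex_derive.
- by apply: cvg_at_right_filter; exact: cF.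
- by apply: cvg_at_left_filter; exact: cF.
Qed.

Lemma subst_inc (F f G : R -> R) (a b : R) : a <= b ->
  (forall t : R, is_derive t (1 : R) F (f t)) -> continuous f ->
  (forall t, a < t < b -> 0 < f t) ->
  {within `[F a, F b], continuous G} ->
  itvint (F a) (F b) G = itvint a b (fun t => G (F t) * f t).
Proof.
move=> ab dF cf f0 cG.
have dFf : derive1 F = f by apply/funext => x; rewrite derive1E derive_val.
have cF : continuous F.
  by move=> x; apply/differentiable_continuous/derivable1_diffP; exact: ex_derive.
rewrite /Rintegral (@integration_by_substitution_increasing _ F G a b) ?dFf//.
- move=> x y xab yab xy; apply: (@gtr0_derive1_lt_cc _ F a b) => //.
  + by move=> t tab; rewrite dFf f0//; rewrite in_itv in tab.
  + exact: continuous_subspaceT.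
- by apply/cvg_ex; exists (f a); apply: cvg_at_right_filter; exact: cf.
- by apply/cvg_ex; exists (f b); apply: cvg_at_left_filter; exact: cf.
- exact: derivable_LR.
Qed.

Lemma subst_dec (F f G : R -> R) (a b : R) : a <= b ->
  (forall t : R, is_derive t (1 : R) F (f t)) -> continuous f ->
  (forall t, a < t < b -> f t < 0) ->
  {within `[F b, F a], continuous G} ->
  itvint (F b) (F a) G = itvint a b (fun t => G (F t) * - f t).
Proof.
move=> ab dF cf f0 cG.
have dFf : derive1 F = f by apply/funext => x; rewrite derive1E derive_val.
have cF : continuous F.
  by move=> x; apply/differentiable_continuous/derivable1_diffP; exact: ex_derive.
rewrite /Rintegral (@integration_by_substitution_decreasing _ F G a b) ?dFf//.
- move=> x y xab yab xy; apply: (@ltr0_derive1_lt_cc _ F a b) => //.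
  + by move=> t tab; rewrite dFf f0//; rewrite in_itv in tab.
  + exact: continuous_subspaceT.
- by apply/cvg_ex; exists (f a); apply: cvg_at_right_filter; exact: cf.
- by apply/cvg_ex; exists (f b); apply: cvg_at_left_filter; exact: cf.
- exact: derivable_LR.
Qed.

Lemma integral_derive_oo (F f : R -> R) (a b : R) : a < b ->
  {within `[a, b], continuous F} -> {within `[a, b], continuous f} ->
  (forall t : R, a < t < b -> is_derive t (1 : R) F (f t)) ->
  (\int[mu]_(t in `]a, b[) (f t)%:E)%E = (F b - F a)%:E.
Proof.
move=> ab cF cf dF; have /(continuous_within_itvP _ ab)[_ Fa Fb] := cF.
rewrite -(@integral_itv_bndoo _ a b _ true false); last first.
  apply/measurable_EFinP; apply: measurable_funS (subspace_continuous_measurable_fun _ cf) => //.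
  exact: subset_itv_oo_cc.
rewrite (@continuous_FTC2 _ f F a b)// ?EFinB//.
- by split => // x; rewrite in_itv/= => xab; exact: (@ex_derive _ _ _ _ _ _ _ (dF _ xab)).
- move=> x; rewrite in_itv/= => xab; rewrite derive1E.
  exact: (@derive_val _ _ _ _ _ _ _ (dF _ xab)).
Qed.

End OneDim.

(** * The divergence theorem on the disc *)

Section Green.
Context {R : realType}.
Notation mu := (@lebesgue_measure R).
Notation itvint a b h := (\int[mu]_(t in `[a, b]) h t)%R.
Implicit Types (P g : R * R -> R).

Lemma slice_derive1 P (x y d : R) : is_derive (x, y) ((1, 0) : R * R) P d ->
  is_derive x (1 : R) (fun s => P (s, y)) d.
Proof.
move=> [dP vP].
have E : (fun h : R => h^-1 *: (((fun s => P (s, y)) \o shift x) (h *: (1 : R)) - P (x, y))) =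
   (fun h : R => h^-1 *: ((P \o shift (x, y)) (h *: ((1, 0) : R * R)) - P (x, y))).
  apply/funext => h; congr (_ *: (P _ - _)) => /=.
  by congr pair; rewrite /= /GRing.scale/= mulr0 add0r.
by split; [rewrite /derivable E|rewrite /derive E].
Qed.

Lemma slice_derive2 P (x y d : R) : is_derive (x, y) ((0, 1) : R * R) P d ->
  is_derive y (1 : R) (fun s => P (x, s)) d.
Proof.
move=> [dP vP].
have E : (fun h : R => h^-1 *: (((fun s => P (x, s)) \o shift y) (h *: (1 : R)) - P (x, y))) =
   (fun h : R => h^-1 *: ((P \o shift (x, y)) (h *: ((0, 1) : R * R)) - P (x, y))).
  apply/funext => h; congr (_ *: (P _ - _)) => /=.
  by congr pair; rewrite /= /GRing.scale/= mulr0 add0r.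
by split; [rewrite /derivable E|rewrite /derive E].
Qed.

Definition half_chord (x : R) : R := Num.sqrt (1 - x ^+ 2).

Lemma half_chord_continuous : continuous half_chord.
Proof.
move=> x; apply: (@continuous_comp _ _ _ (fun x : R => 1 - x ^+ 2) Num.sqrt).
  by apply: cvgB; [exact: cvg_cst|exact: exprn_continuous].
exact: sqrt_continuous.
Qed.

Lemma half_chord_sqr (x : R) : -1 <= x <= 1 -> half_chord x ^+ 2 = 1 - x ^+ 2.
Proof. by move=> x1; rewrite sqr_sqrtr//; nra. Qed.

Lemma lt_half_chord (x y : R) : -1 < x < 1 -> (x ^+ 2 + y ^+ 2 < 1) = (- half_chord x < y < half_chord x).
Proof.
move=> x1; have h := @half_chord_sqr x ltac:(lra).
have h0 : 0 <= half_chord x by exact: sqrtr_ge0.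
by apply/idP/idP => [H|H]; [apply/andP; split; nra|nra].
Qed.

Lemma le_half_chord (x y : R) : -1 <= x <= 1 -> - half_chord x <= y <= half_chord x -> x ^+ 2 + y ^+ 2 <= 1.
Proof. by move=> x1 yh; have h := @half_chord_sqr x ltac:(lra); nra. Qed.

Lemma half_chord_gt0 (x : R) : -1 < x < 1 -> 0 < half_chord x.
Proof. by move=> x1; rewrite sqrtr_gt0; nra. Qed.

Lemma graph_continuous1 P (c : R -> R) (a b : R) : {within @cdisc R, continuous P} -> continuous c ->
  (forall x, a <= x <= b -> x ^+ 2 + c x ^+ 2 <= 1) ->
  {within `[a, b], continuous (fun x => P (x, c x))}.
Proof.
move=> cP cc h; apply: (@within_comp _ _ _ _ (@cdisc R) (fun x => (x, c x)) P) => //.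
  apply: continuous_subspaceT => x; apply: (@cvg_pair _ _ _ (nbhs x) (nbhs x) (nbhs (c x)) _ _ _ id c); [exact: cvg_id|exact: cc].
Qed.

Lemma graph_continuous2 P (c : R -> R) (a b : R) : {within @cdisc R, continuous P} -> continuous c ->
  (forall x, a <= x <= b -> c x ^+ 2 + x ^+ 2 <= 1) ->
  {within `[a, b], continuous (fun x => P (c x, x))}.
Proof.
move=> cP cc h; apply: (@within_comp _ _ _ _ (@cdisc R) (fun x => (c x, x)) P) => //.
  apply: continuous_subspaceT => x; apply: (@cvg_pair _ _ _ (nbhs x) (nbhs (c x)) (nbhs x) _ _ _ c id); [exact: cc|exact: cvg_id].
Qed.

(** Fubini's theorem, and the fundamental theorem of calculus on each vertical
    chord. *)
Lemma slice2 P g : {within @cdisc R, continuous P} -> {within @cdisc R, continuous g} ->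
  (forall z, @disc R z -> is_derive z ((0, 1) : R * R) P (g z)) ->
  int_disc g = itvint (-1) 1 (fun x => P (x, half_chord x) - P (x, - half_chord x)).
Proof.
move=> cP cg dP; rewrite /int_disc /Rintegral; congr fine.
pose f := (fun z => (g z)%:E) \_ (@disc R).
have if_ : (@leb2 R).-integrable setT f.
  by apply/(integrable_mkcond _ (@measurable_disc R)); exact: L1_wcont.
rewrite integral_mkcond -/f -(integral12_prod_meas1 if_).
pose k x := P (x, half_chord x) - P (x, - half_chord x).
have ck : {within `[-1, 1], continuous k}.
  have cN : continuous (fun x => - half_chord x) by move=> x; apply: cvgN; exact: half_chord_continuous.
  move=> x; apply: cvgB.
    apply: (graph_continuous1 cP half_chord_continuous) => {}x x1.
    by have h0 : 0 <= half_chord x := sqrtr_ge0 _; apply: le_half_chord => //; rewrite lexx andbT; lra.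
  apply: (graph_continuous1 cP cN) => {}x x1.
  by have h0 : 0 <= half_chord x := sqrtr_ge0 _; apply: le_half_chord => //; rewrite lexx/=; lra.
pose K : R -> \bar R := (fun x : R => (k x)%:E) \_ `]-1, 1[%classic.
have HK (x : R) : fubini_F mu f x = K x.
  rewrite /K patchE.
  case: ifPn => [|]; rewrite ?inE/= ?notin_setE /= in_itv/=.
    move=> x1.
    pose K' : R -> \bar R := (fun y : R => (g (x, y))%:E) \_ `](- half_chord x), (half_chord x)[%classic.
    transitivity (\int[mu]_y K' y)%E.
      apply: eq_integral => y _; rewrite /K' /f !patchE.
      have -> : ((x, y) \in @disc R) = (y \in `](- half_chord x), (half_chord x)[%classic).
        by apply/idP/idP; rewrite !inE /disc/= in_itv/= lt_half_chord.
      by [].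
    rewrite -integral_mkcond.
    have h0 := half_chord_gt0 x1.
    apply: (@integral_derive_oo _ (fun y => P (x, y)) (fun y => g (x, y))); first lra.
    - apply: (@within_comp _ _ _ _ (@cdisc R) (fun y => (x, y)) P) => //.
        by apply: continuous_subspaceT => y; apply: (@cvg_pair _ _ _ (nbhs y) (nbhs x) (nbhs y) _ _ _ (cst x) id); [exact: cvg_cst|exact: cvg_id].
      move=> y; rewrite /= in_itv/= => yh; apply: le_half_chord => //=; lra.
    - apply: (@within_comp _ _ _ _ (@cdisc R) (fun y => (x, y)) g) => //.
        by apply: continuous_subspaceT => y; apply: (@cvg_pair _ _ _ (nbhs y) (nbhs x) (nbhs y) _ _ _ (cst x) id); [exact: cvg_cst|exact: cvg_id].
      by move=> y; rewrite /= in_itv/= => yh; apply: le_half_chord => //=; lra.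
    - by move=> y yh; apply/slice_derive2/dP; rewrite /disc/= lt_half_chord.
  move=> x1; rewrite /fubini_F; apply: integral0_eq => y _.
  rewrite /f patchE; case: ifPn => //; rewrite inE/= /disc/= => xy.
  by exfalso; apply: x1; nra.
transitivity (\int[mu]_x K x)%E; first by apply: eq_integral => x _; exact: HK.
rewrite -integral_mkcond (@integral_itv_bndoo _ _ _ _ true false)//.
apply/measurable_EFinP; apply: measurable_funS (subspace_continuous_measurable_fun _ ck) => //.
exact: subset_itv_oo_cc.
Qed.

Lemma slice1 P g : {within @cdisc R, continuous P} -> {within @cdisc R, continuous g} ->
  (forall z, @disc R z -> is_derive z ((1, 0) : R * R) P (g z)) ->
  int_disc g = itvint (-1) 1 (fun x => P (half_chord x, x) - P (- half_chord x, x)).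
Proof.
move=> cP cg dP; rewrite /int_disc /Rintegral; congr fine.
pose f := (fun z => (g z)%:E) \_ (@disc R).
have if_ : (@leb2 R).-integrable setT f.
  by apply/(integrable_mkcond _ (@measurable_disc R)); exact: L1_wcont.
rewrite integral_mkcond -/f -(integral21_prod_meas1 if_).
pose k x := P (half_chord x, x) - P (- half_chord x, x).
have ck : {within `[-1, 1], continuous k}.
  have cN : continuous (fun x => - half_chord x) by move=> x; apply: cvgN; exact: half_chord_continuous.
  move=> x; apply: cvgB.
    apply: (graph_continuous2 cP half_chord_continuous) => {}x x1.
    by have h0 : 0 <= half_chord x := sqrtr_ge0 _; rewrite addrC; apply: le_half_chord => //; rewrite lexx andbT; lra.
  apply: (graph_continuous2 cP cN) => {}x x1.
  by have h0 : 0 <= half_chord x := sqrtr_ge0 _; rewrite addrC; apply: le_half_chord => //; rewrite lexx/=; lra.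
pose K : R -> \bar R := (fun x : R => (k x)%:E) \_ `]-1, 1[%classic.
have HK (x : R) : fubini_G mu f x = K x.
  rewrite /K patchE.
  case: ifPn => [|]; rewrite ?inE/= ?notin_setE /= in_itv/=.
    move=> x1.
    pose K' : R -> \bar R := (fun y : R => (g (y, x))%:E) \_ `](- half_chord x), (half_chord x)[%classic.
    transitivity (\int[mu]_y K' y)%E.
      apply: eq_integral => y _; rewrite /K' /f !patchE.
      have -> : ((y, x) \in @disc R) = (y \in `](- half_chord x), (half_chord x)[%classic).
        by apply/idP/idP; rewrite !inE /disc/= in_itv/= addrC lt_half_chord.
      by [].
    rewrite -integral_mkcond.
    have h0 := half_chord_gt0 x1.
    apply: (@integral_derive_oo _ (fun y => P (y, x)) (fun y => g (y, x))); first lra.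
    - apply: (@within_comp _ _ _ _ (@cdisc R) (fun y => (y, x)) P) => //.
        by apply: continuous_subspaceT => y; apply: (@cvg_pair _ _ _ (nbhs y) (nbhs y) (nbhs x) _ _ _ id (cst x)); [exact: cvg_id|exact: cvg_cst].
      move=> y; rewrite /= in_itv/= => yh; rewrite /cdisc/= addrC; apply: le_half_chord => //=; lra.
    - apply: (@within_comp _ _ _ _ (@cdisc R) (fun y => (y, x)) g) => //.
        by apply: continuous_subspaceT => y; apply: (@cvg_pair _ _ _ (nbhs y) (nbhs y) (nbhs x) _ _ _ id (cst x)); [exact: cvg_id|exact: cvg_cst].
      by move=> y; rewrite /= in_itv/= => yh; rewrite /cdisc/= addrC; apply: le_half_chord => //=; lra.
    - by move=> y yh; apply/slice_derive1/dP; rewrite /disc/= addrC lt_half_chord.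
  move=> x1; rewrite /fubini_G; apply: integral0_eq => y _.
  rewrite /f patchE; case: ifPn => //; rewrite inE/= /disc/= => xy.
  by exfalso; apply: x1; nra.
transitivity (\int[mu]_x K x)%E; first by apply: eq_integral => x _; exact: HK.
rewrite -integral_mkcond (@integral_itv_bndoo _ _ _ _ true false)//.
apply/measurable_EFinP; apply: measurable_funS (subspace_continuous_measurable_fun _ ck) => //.
exact: subset_itv_oo_cc.
Qed.

Lemma half_chord_cos t : half_chord (cos t) = `|sin t|.
Proof. by rewrite /half_chord -(cos2Dsin2 t) addrC addKr sqrtr_sqr. Qed.

Lemma half_chord_sin t : half_chord (sin t) = `|cos t|.
Proof. by rewrite /half_chord -(cos2Dsin2 t) addrK sqrtr_sqr. Qed.

Lemma circle_pt_cdisc t : @cdisc R (circle_pt t).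
Proof. by rewrite /cdisc/= cos2Dsin2. Qed.

Lemma circle_pt_continuous : continuous (@circle_pt R).
Proof.
move=> t; apply: (@cvg_pair _ _ _ (nbhs t) (nbhs (cos t)) (nbhs (sin t)) _ _ _ cos sin).
  exact: continuous_cos.
exact: continuous_sin.
Qed.

Lemma trace_continuous P : {within @cdisc R, continuous P} ->
  continuous (fun t => P (circle_pt t)).
Proof.
move=> cP; apply/continuous_subspace_setT; apply: within_comp cP.
  exact: (continuous_subspaceT circle_pt_continuous).
by move=> s _; exact: circle_pt_cdisc.
Qed.

(** Substitute x = cos t: the upper half circle is t in [0, pi], the lower one is
    t in [pi, 2 pi]. *)
Lemma green2 P g : {within @cdisc R, continuous P} -> {within @cdisc R, continuous g} ->
  (forall z, @disc R z -> is_derive z ((0, 1) : R * R) P (g z)) ->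
  int_disc g = itvint 0 (2 * pi) (fun t => P (circle_pt t) * sin t).
Proof.
move=> cP cg dP; rewrite (slice2 cP cg dP).
have pi0 := @pi_gt0 R.
have cos2 : cos (2 * pi) = 1 :> R by rewrite mulr_natl cos2pi.
have cN : continuous (fun x => - half_chord x) by move=> x; apply: cvgN; exact: half_chord_continuous.
have cT := trace_continuous cP.
have c1 : {within `[-1, 1], continuous (fun x => P (x, half_chord x))}.
  apply: (graph_continuous1 cP half_chord_continuous) => x x1.
  by have h0 : 0 <= half_chord x := sqrtr_ge0 _; apply: le_half_chord => //; rewrite lexx andbT; lra.
have c2 : {within `[-1, 1], continuous (fun x => P (x, - half_chord x))}.
  apply: (graph_continuous1 cP cN) => x x1.
  by have h0 : 0 <= half_chord x := sqrtr_ge0 _; apply: le_half_chord => //; rewrite lexx/=; lra.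
have i1 := continuous_compact_integrable (@segment_compact R (-1) 1) c1.
have i2 := continuous_compact_integrable (@segment_compact R (-1) 1) c2.
rewrite RintegralB//.
have ch a b : {within `[a, b], continuous (fun t => P (circle_pt t) * sin t)}.
  apply: continuous_subspaceT => t; exact: (cvgM (cT t) (@continuous_sin R t)).
rewrite (@int_split _ _ 0 pi (2 * pi) (ltW pi0) ltac:(lra) (ch _ _)).
congr (_ + _).
  have := @subst_dec R cos (fun t => - sin t) (fun x => P (x, half_chord x)) 0 pi (ltW pi0).
  rewrite cospi cos0 => ->//.
  - apply: eq_Rintegral => t; rewrite inE/= in_itv/= => t1.
    by rewrite opprK half_chord_cos ger0_norm ?sin_ge0_pi.
  - by move=> t; apply: cvgN; exact: continuous_sin.
  - by move=> t t1; rewrite oppr_lt0 sin_gt0_pi.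
have := @subst_inc R cos (fun t => - sin t) (fun x => P (x, - half_chord x)) pi (2 * pi) ltac:(lra).
rewrite cospi cos2 => -> //.
- rewrite -[RHS]opprK; congr (- _).
  rewrite -mulN1r -RintegralZl//; last first.
    apply: continuous_compact_integrable; first exact: segment_compact.
    exact: ch.
  apply: eq_Rintegral => t; rewrite inE/= in_itv/= => t1.
  have : 0 <= sin (t - pi) by rewrite sin_ge0_pi//; lra.
  have -> : sin (t - pi) = - sin t by rewrite -[in RHS](subrK pi t) sinDpi opprK.
  by move=> s0; rewrite half_chord_cos ler0_norm ?opprK; [ring|lra].
- by move=> t; apply: cvgN; exact: continuous_sin.
- move=> t t1; have : 0 < sin (t - pi) by rewrite sin_gt0_pi//; lra.
  by have -> : sin (t - pi) = - sin t by rewrite -[in RHS](subrK pi t) sinDpi opprK.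
Qed.

(** Substitute y = sin t.  The left half circle is t in [pi / 2, 3 pi / 2]; the
    right one consists of the two pieces [0, pi / 2] and [3 pi / 2, 2 pi], which
    parametrize the chords with y >= 0 and with y <= 0. *)
Lemma green1 P g : {within @cdisc R, continuous P} -> {within @cdisc R, continuous g} ->
  (forall z, @disc R z -> is_derive z ((1, 0) : R * R) P (g z)) ->
  int_disc g = itvint 0 (2 * pi) (fun t => P (circle_pt t) * cos t).
Proof.
move=> cP cg dP; rewrite (slice1 cP cg dP).
have pi0 := @pi_gt0 R.
have sin32 : sin (pi / 2 + pi) = -1 :> R by rewrite sinDpi sin_pihalf.
have sin2 : sin (2 * pi) = 0 :> R by rewrite mulr_natl sin2pi.
have cN : continuous (fun x => - half_chord x) by move=> x; apply: cvgN; exact: half_chord_continuous.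
have cT := trace_continuous cP.
have c1 : {within `[-1, 1], continuous (fun x => P (half_chord x, x))}.
  apply: (graph_continuous2 cP half_chord_continuous) => x x1.
  by have h0 : 0 <= half_chord x := sqrtr_ge0 _; rewrite addrC; apply: le_half_chord => //; rewrite lexx andbT; lra.
have c2 : {within `[-1, 1], continuous (fun x => P (- half_chord x, x))}.
  apply: (graph_continuous2 cP cN) => x x1.
  by have h0 : 0 <= half_chord x := sqrtr_ge0 _; rewrite addrC; apply: le_half_chord => //; rewrite lexx/=; lra.
have i1 := continuous_compact_integrable (@segment_compact R (-1) 1) c1.
have i2 := continuous_compact_integrable (@segment_compact R (-1) 1) c2.
have ch a b : {within `[a, b], continuous (fun t => P (circle_pt t) * cos t)}.
  by apply: continuous_subspaceT => t; exact: (cvgM (cT t) (@continuous_cos R t)).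
rewrite RintegralB//.
rewrite (@int_split _ _ _ (pi / 2) (2 * pi)) ?(@int_split _ _ (pi / 2) (pi / 2 + pi) (2 * pi)); try lra; try exact: ch.
rewrite (@int_split _ _ (-1) 0 1) ?(lerN10) ?ler01//.
have E1 : itvint 0 1 (fun x => P (half_chord x, x)) = itvint 0 (pi / 2) (fun t => P (circle_pt t) * cos t).
  have := @subst_inc R sin cos (fun x => P (half_chord x, x)) 0 (pi / 2) ltac:(lra).
  rewrite sin0 sin_pihalf => -> //.
  - apply: eq_Rintegral => t; rewrite inE/= in_itv/= => t1.
    by rewrite half_chord_sin ger0_norm ?cos_ge0_pihalf//; lra.
  - exact: continuous_cos.
  - by move=> t t1; rewrite cos_gt0_pihalf//; lra.
  - by apply: continuous_subspaceW c1; apply: subset_itvr; rewrite bnd_simp; lra.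
have E2 : itvint (-1) 0 (fun x => P (half_chord x, x)) =
    itvint (pi / 2 + pi) (2 * pi) (fun t => P (circle_pt t) * cos t).
  have := @subst_inc R sin cos (fun x => P (half_chord x, x)) (pi / 2 + pi) (2 * pi) ltac:(lra).
  rewrite sin2 sin32 => -> //.
  - apply: eq_Rintegral => t; rewrite inE/= in_itv/= => t1.
    have : 0 <= cos (t - 2 * pi) by rewrite cos_ge0_pihalf//; lra.
    have -> : cos (t - 2 * pi) = cos t.
      by rewrite -[in RHS](subrK (2 * pi) t) mulr_natl cosD2pi.
    by move=> s0; rewrite half_chord_sin ger0_norm.
  - exact: continuous_cos.
  - move=> t t1; have : 0 < cos (t - 2 * pi) by rewrite cos_gt0_pihalf//; lra.
    have -> // : cos (t - 2 * pi) = cos t.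
    by rewrite -[in RHS](subrK (2 * pi) t) mulr_natl cosD2pi.
  - by apply: continuous_subspaceW c1; apply: subset_itvl; rewrite bnd_simp; lra.
have E3 : itvint (-1) 1 (fun x => P (- half_chord x, x)) =
    - itvint (pi / 2) (pi / 2 + pi) (fun t => P (circle_pt t) * cos t).
  have cosp t : cos (t - pi) = - cos t by rewrite -[in RHS](subrK pi t) cosDpi opprK.
  have := @subst_dec R sin cos (fun x => P (- half_chord x, x)) (pi / 2) (pi / 2 + pi) ltac:(lra).
  rewrite sin_pihalf sin32 => -> //.
  - rewrite -mulN1r -RintegralZl//; last first.
      by apply: continuous_compact_integrable; [exact: segment_compact|exact: ch].
    apply: eq_Rintegral => t; rewrite inE/= in_itv/= => t1.
    have : 0 <= cos (t - pi) by rewrite cos_ge0_pihalf//; lra.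
    by rewrite cosp => s0; rewrite half_chord_sin ler0_norm ?opprK; [ring|lra].
  - exact: continuous_cos.
  - move=> t t1; have : 0 < cos (t - pi) by rewrite cos_gt0_pihalf//; lra.
    by rewrite cosp oppr_gt0.
by rewrite E1 E2 E3; ring.
Qed.
End Green.

(** * Traces against tangential derivatives *)

Lemma normr_le_int d (T : measurableType d) (R : realType) (mu : {measure set T -> \bar R})
  (D : set T) (f K : T -> R) (M : R) : measurable D -> mu.-integrable D (EFin \o f) ->
  measurable_fun D K -> 0 <= M -> (forall x, D x -> 0 <= K x) ->
  (forall x, D x -> `|f x| <= M * K x) ->
  ((`|\int[mu]_(x in D) f x|%R)%:E <= M%:E * \int[mu]_(x in D) (K x)%:E)%E.
Proof.
move=> mD fi mK M0 K0 fK; rewrite EFin_normr_Rintegral//.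
have /integrableP[mf _] := fi.
apply: le_trans (le_abse_integral _ mD mf) _.
have mK' : measurable_fun D (EFin \o K) by exact/measurable_EFinP.
rewrite -(@ge0_integralZl _ _ _ mu D mD (EFin \o K) mK' M%:E)//.
apply: ge0_le_integral => //.
- exact: measurableT_comp.
- by apply/measurable_EFinP; apply: measurable_funM.
Qed.

Section Trace.
Context {R : realType}.
Notation mu := (@lebesgue_measure R).
Implicit Types (u G : R * R -> R) (Du : R * R -> R * R).

Lemma angles_measurable : @measurable _ (measurableTypeR R) (@angles R).
Proof. exact: measurable_itv. Qed.

Lemma int_circle_cc (h : R -> R) : {within `[0, 2 * pi], continuous h} ->
  int_circle h = \int[mu]_(t in `[0, 2 * pi]) h t.
Proof.
move=> ch; rewrite /int_circle /angles Rintegral_itv_bndo_bndc//.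
have ih := continuous_compact_integrable (@segment_compact R 0 (2 * pi)) ch.
apply: integrableS ih => //.
by apply: subset_itvl; rewrite bnd_simp.
Qed.

Lemma circle_integrable (h : R -> R) : continuous h ->
  mu.-integrable (@angles R) (EFin \o h).
Proof.
move=> ch.
have ih := continuous_compact_integrable (@segment_compact R 0 (2 * pi)) (continuous_subspaceT ch).
apply: integrableS ih => //; first exact: angles_measurable.
by apply: subset_itvl; rewrite bnd_simp.
Qed.

Section Potential.
Variables (U : set (R * R)) (G g1 g2 h11 h12 h22 : R * R -> R).
Hypothesis DU : @cdisc R `<=` U.
Hypothesis gG : forall z, U z -> isgrad G z (g1 z) (g2 z).
Hypothesis gg1 : forall z, U z -> isgrad g1 z (h11 z) (h12 z).
Hypothesis gg2 : forall z, U z -> isgrad g2 z (h12 z) (h22 z).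
Hypothesis ch12 : forall z, U z -> {for z, continuous h12}.

Let cU f : (forall z, U z -> {for z, continuous f}) -> {within @cdisc R, continuous (f : R * R -> R)}.
Proof. by move=> cf; apply: continuous_in_subspaceT => z /set_mem/DU; exact: cf. Qed.

Let cg1 : {within @cdisc R, continuous g1}.
Proof. by apply: cU => z /gg1; exact: isgrad_continuous. Qed.
Let cg2 : {within @cdisc R, continuous g2}.
Proof. by apply: cU => z /gg2; exact: isgrad_continuous. Qed.

Lemma dtauE t : dtau G t = - (g1 (circle_pt t) * sin t) + g2 (circle_pt t) * cos t.
Proof.
rewrite /dtau derive1E; have h := isgrad_circle (gG (DU (circle_pt_cdisc t))).
by rewrite (@derive_val _ _ _ _ _ _ _ h).
Qed.

Lemma dtau_continuous : continuous (dtau G).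
Proof.
rewrite (_ : dtau G = fun t => - (g1 (circle_pt t) * sin t) + g2 (circle_pt t) * cos t);
  last by apply/funext => t; exact: dtauE.
move=> t; apply: cvgD; first apply: cvgN.
  exact: (cvgM (trace_continuous cg1 (x:=t)) (@continuous_sin R t)).
exact: (cvgM (trace_continuous cg2 (x:=t)) (@continuous_cos R t)).
Qed.

(** The field (phi g2, - phi g1) has divergence p1 g2 - p2 g1, since the mixed
    derivatives of G cancel, and its flux density through the circle is
    phi times the tangential derivative of G. *)
Lemma smooth_green (phi p1 p2 : R * R -> R) : {within @cdisc R, continuous phi} ->
  {within @cdisc R, continuous p1} -> {within @cdisc R, continuous p2} ->
  (forall z, @disc R z -> is_derive z ((1, 0) : R * R) phi (p1 z) /\
                          is_derive z ((0, 1) : R * R) phi (p2 z)) ->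
  int_circle (fun t => phi (circle_pt t) * dtau G t) =
  int_disc (fun z => p1 z * g2 z - p2 z * g1 z).
Proof.
move=> cp cp1 cp2 dp.
have ch : {within @cdisc R, continuous h12} by exact: cU.
have wM (f g : R * R -> R) : {within @cdisc R, continuous f} -> {within @cdisc R, continuous g} ->
    {within @cdisc R, continuous (fun z => f z * g z : R)}.
  by move=> cf cg z; exact: (cvgM (cf z) (cg z)).
have wD (f g : R * R -> R) : {within @cdisc R, continuous f} -> {within @cdisc R, continuous g} ->
    {within @cdisc R, continuous (fun z => f z + g z : R)}.
  by move=> cf cg z; exact: (cvgD (cf z) (cg z)).
have c1 := wD _ _ (wM _ _ cp1 cg2) (wM _ _ cp ch).
have c2 := wD _ _ (wM _ _ cp2 cg1) (wM _ _ cp ch).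
have dP1 z : @disc R z ->
    is_derive z ((1, 0) : R * R) (fun z => phi z * g2 z) (p1 z * g2 z + phi z * h12 z).
  move=> Dz; have [d1z _] := dp z Dz.
  have [dg _] := isgrad_is_derive (gg2 (DU (disc_cdisc Dz))).
  by apply: (is_derive_eq (is_deriveM d1z dg)); rewrite /GRing.scale/=; ring.
have dP2 z : @disc R z ->
    is_derive z ((0, 1) : R * R) (fun z => phi z * g1 z) (p2 z * g1 z + phi z * h12 z).
  move=> Dz; have [_ d2z] := dp z Dz.
  have [_ dg] := isgrad_is_derive (gg1 (DU (disc_cdisc Dz))).
  by apply: (is_derive_eq (is_deriveM d2z dg)); rewrite /GRing.scale/=; ring.
have E1 := green1 (wM _ _ cp cg2) c1 dP1.
have E2 := green2 (wM _ _ cp cg1) c2 dP2.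
transitivity (int_disc (fun z => p1 z * g2 z + phi z * h12 z) -
              int_disc (fun z => p2 z * g1 z + phi z * h12 z)); last first.
  rewrite /int_disc -RintegralB//; [|exact: measurable_disc|exact: L1_wcont|exact: L1_wcont].
  by apply: eq_Rintegral => z _; ring.
rewrite E1 E2.
have cT1 := trace_continuous (wM _ _ cp cg1).
have cT2 := trace_continuous (wM _ _ cp cg2).
have k1 : continuous (fun t => phi (circle_pt t) * g2 (circle_pt t) * cos t).
  by move=> t; exact: (cvgM (cT2 t) (@continuous_cos R t)).
have k2 : continuous (fun t => phi (circle_pt t) * g1 (circle_pt t) * sin t).
  by move=> t; exact: (cvgM (cT1 t) (@continuous_sin R t)).
have i1 := continuous_compact_integrable (@segment_compact R 0 (2 * pi)) (continuous_subspaceT k1).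
have i2 := continuous_compact_integrable (@segment_compact R 0 (2 * pi)) (continuous_subspaceT k2).
rewrite -RintegralB// int_circle_cc.
  by apply: eq_Rintegral => t _; rewrite dtauE; ring.
apply: continuous_subspaceT => t.
exact: (cvgM (trace_continuous cp (x:=t)) (@dtau_continuous t)).
Qed.

(** Both sides of [smooth_green] are continuous for the convergence that defines
    the trace, because g1, g2 and the tangential derivative of G are bounded. *)
Lemma trace_green u Du w : L1_disc (fun z => (Du z).1) -> L1_disc (fun z => (Du z).2) ->
  is_trace u Du w ->
  int_circle (fun t => w (circle_pt t) * dtau G t) =
  int_disc (fun z => (Du z).1 * g2 z - (Du z).2 * g1 z).
Proof.
move=> Du1 Du2 [Lw [phi [phiC1 _ cD cw]]].
have [M1 M10 HM1] := wcont_bounded cg1.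
have [M2 M20 HM2] := wcont_bounded cg2.
pose M := M1 + M2.
have M0 : 0 <= M by exact: addr_ge0.
have dtauM t : `|dtau G t| <= M.
  rewrite dtauE (le_trans (ler_normD _ _))// lerD// ?normrN normrM.
    by rewrite -[leRHS]mulr1 ler_pM// ?HM1//; [exact: circle_pt_cdisc|exact: sin_max].
  by rewrite -[leRHS]mulr1 ler_pM// ?HM2//; [exact: circle_pt_cdisc|exact: cos_max].
apply/eqP; rewrite -subr_eq0 -normr_le0 -lee_fin.
pose X k := (\int[@leb2 R]_(z in @disc R)
           (`|d1 (phi k) z - (Du z).1| + `|d2 (phi k) z - (Du z).2|)%:E)%E.
pose Y k := (\int[mu]_(t in @angles R) `|phi k (circle_pt t) - w (circle_pt t)|%:E)%E.
have cXY : (M%:E * (Y k + X k))%E @[k --> \oo] --> 0%E.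
  have -> : 0%E = (M%:E * (0 + 0))%E :> \bar R by rewrite adde0 mule0.
  by apply: cvgeZl => //; apply: cvgeD.
apply: (cvge_ge _ cXY); near=> k.
have [cphi [p1 [p2 [dp [[cp1 _] [cp2 _]]]]]] := phiC1 k.
have E := smooth_green cphi cp1 cp2 dp.
have d1E z : @disc R z -> d1 (phi k) z = p1 z.
  by move=> /dp[h _]; rewrite /d1 (@derive_val _ _ _ _ _ _ _ h).
have d2E z : @disc R z -> d2 (phi k) z = p2 z.
  by move=> /dp[_ h]; rewrite /d2 (@derive_val _ _ _ _ _ _ _ h).
set A := int_disc _; set B := int_circle _.
set Bk := int_circle _ in E; set Ak := int_disc _ in E.
have -> : B - A = (B - Bk) + (Ak - A) by rewrite -E; ring.
have cdt := dtau_continuous.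
have mdt : @measurable_fun _ _ (measurableTypeR R) R (@angles R) (dtau G).
  by apply: measurable_funTS; exact: continuous_measurable_fun.
have iw : mu.-integrable (@angles R) (fun t => (w (circle_pt t) * dtau G t)%:E).
  have /integrableP[/measurable_EFinP mw _] := Lw.
  apply: (le_integrable angles_measurable _ _ (integrableZl angles_measurable M Lw)).
    by apply/measurable_EFinP; apply: measurable_funM.
  by move=> t _; rewrite -EFinM lee_fin !normrM (ger0_norm M0) mulrC ler_wpM2r.
have cpt : continuous (fun t => phi k (circle_pt t)) by exact: trace_continuous.
have ip : mu.-integrable (@angles R) (fun t => (phi k (circle_pt t) * dtau G t)%:E).
  by apply: circle_integrable => t; exact: (cvgM (cpt t) (cdt t)).
have HB : ((`|B - Bk|)%:E <= M%:E * Y k)%E.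
  rewrite /B /Bk /int_circle -RintegralB//; last exact: angles_measurable.
  apply: normr_le_int => //; first exact: angles_measurable.
  - exact: (integrableB angles_measurable iw ip).
  - apply: measurableT_comp => //; apply: measurable_funB.
      by apply: measurable_funTS; exact: continuous_measurable_fun.
    by have /integrableP[/measurable_EFinP] := Lw.
  - move=> t _; rewrite -mulrBl normrM mulrC distrC.
    by rewrite ler_wpM2r.
have i1 := L1_wcont cp1; have i2 := L1_wcont cp2.
have L1B (f g : R * R -> R) : L1_disc f -> L1_disc g -> L1_disc (fun z => f z - g z : R).
  by move=> fi gi; exact: (integrableB (@measurable_disc R) fi gi).
have HA : ((`|Ak - A|)%:E <= M%:E * X k)%E.
  rewrite /A /Ak /int_disc -RintegralB//; first last.
  - by apply: L1B; exact: L1_mul.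
  - by apply: L1B; exact: L1_mul.
  - exact: measurable_disc.
  apply: normr_le_int => //; first exact: measurable_disc.
  - by apply: (@L1B (fun z => p1 z * g2 z - p2 z * g1 z)
       (fun z => (Du z).1 * g2 z - (Du z).2 * g1 z)); apply: L1B; exact: L1_mul.
  - apply: (@eq_measurable_fun _ _ _ _ _ (fun z => `|p1 z - (Du z).1| + `|p2 z - (Du z).2|)).
      by move=> z; rewrite inE => Dz; rewrite d1E// d2E.
    have /integrableP[/measurable_EFinP m1 _] := L1B _ _ i1 Du1.
    have /integrableP[/measurable_EFinP m2 _] := L1B _ _ i2 Du2.
    by apply: measurable_funD; apply: measurableT_comp.
  - move=> z Dz; rewrite d1E// d2E//.
    have -> : p1 z * g2 z - p2 z * g1 z - ((Du z).1 * g2 z - (Du z).2 * g1 z) =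
       g2 z * (p1 z - (Du z).1) - g1 z * (p2 z - (Du z).2) by ring.
    rewrite (le_trans (ler_normB _ _))// !normrM mulrDr.
    have := HM1 _ (disc_cdisc Dz); have := HM2 _ (disc_cdisc Dz) => h2 h1.
    by rewrite lerD// ler_wpM2r// (le_trans h2 _, le_trans h1 _) /M ?lerDr ?lerDl.
rewrite muleDr//; last by apply: ge0_adde_def; rewrite inE; apply: integral_ge0 => *; rewrite lee_fin// addr_ge0.
apply: le_trans (leeD HB HA); rewrite -EFinD lee_fin; exact: ler_normD.
Unshelve. all: by end_near.
Qed.

End Potential.
End Trace.

(** * Dyadic estimates around a pole outside the disc *)

(** Both the energy of the test function and the Lorentz norm of the fields are
    estimated through this lemma, with dyadic squares and dyadic intervals. *)
Lemma step_int d (T : measurableType d) (R : realType) (mu : {measure set T -> \bar R})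
  (D : set T) (f : T -> R) (m : nat) (c v : nat -> R) (B : nat -> set T) :
  measurable D -> measurable_fun D f -> (forall x, D x -> 0 <= f x) ->
  (forall k, 0 <= c k) -> (forall k, measurable (B k)) ->
  (forall k, (mu (B k) <= (v k)%:E)%E) ->
  (forall x, D x -> f x <= \sum_(k < m) c k * \1_(B k) x) ->
  (\int[mu]_(x in D) (f x)%:E <= (\sum_(k < m) c k * v k)%:E)%E.
Proof.
move=> mD mf f0 c0 mB Bv fc.
have m1 (k : 'I_m) : measurable_fun D (fun x => ((c k)%:E * (\1_(B k) x)%:E)%E).
  by apply: measurable_funeM; apply/measurable_EFinP; exact: measurable_indic.
apply: (@le_trans _ _ (\int[mu]_(x in D) (\sum_(k < m) ((c k)%:E * (\1_(B k) x)%:E))%E)%E).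
  apply: ge0_le_integral => //.
  - exact/measurable_EFinP.
  - exact: emeasurable_sum.
  - move=> x Dx; under eq_bigr do rewrite -EFinM.
    by rewrite sumEFin lee_fin fc.
rewrite ge0_integral_sum//; last first.
  by move=> k x _; rewrite mule_ge0// lee_fin.
rewrite -sumEFin; apply: lee_sum => k _.
have h0 x : D x -> (0 <= (\1_(B k) x)%:E :> \bar R)%E by move=> _; rewrite lee_fin.
have hm : measurable_fun D (fun x => (\1_(B k) x)%:E : \bar R).
  by apply/measurable_EFinP; exact: measurable_indic.
rewrite (ge0_integralZl_EFin mu mD h0 hm (c0 k)).
rewrite integral_indic// EFinM lee_wpmul2l ?lee_fin//.
by apply: le_trans (Bv k); apply: le_measure; rewrite ?inE//; exact: measurableI.
Qed.

Lemma sum_expr_le (R : realType) (x : R) m : 2 <= x -> \sum_(k < m) x ^+ k <= x ^+ m.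
Proof.
move=> x2; elim: m => [|m IH]; first by rewrite big_ord0 expr0.
rewrite big_ord_recr/= exprS.
have : 0 <= x ^+ m by rewrite exprn_ge0//; lra.
by nra.
Qed.

Section Dyadic.
Context {R : realType}.
Variables (p : R * R) (n : nat).
Hypothesis p1 : p.1 ^+ 2 + p.2 ^+ 2 = 1.

Definition eps : R := 2^-1 ^+ n.
Definition kap : R := 1 + eps.
(** The pole is kap p. *)
Definition sqdist (z : R * R) : R := (z.1 - kap * p.1) ^+ 2 + (z.2 - kap * p.2) ^+ 2.
(** Coordinates in the orthonormal frame formed by p and the counterclockwise
    tangent at p. *)
Definition ncomp (z : R * R) : R := p.1 * z.1 + p.2 * z.2.
Definition tcomp (z : R * R) : R := p.1 * z.2 - p.2 * z.1.

Lemma eps_gt0 : 0 < eps. Proof. by rewrite exprn_gt0// invr_gt0. Qed.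
Lemma eps_le1 : eps <= 1. Proof. by rewrite exprn_ile1 ?invr_ge0// invf_le1// ler1n. Qed.

Lemma sqdist_frame z : sqdist z = tcomp z ^+ 2 + (ncomp z - kap) ^+ 2.
Proof.
suff: tcomp z ^+ 2 + (ncomp z - kap) ^+ 2 - sqdist z =
  (p.1 ^+ 2 + p.2 ^+ 2 - 1) * (z.1 ^+ 2 + z.2 ^+ 2 - kap ^+ 2) by rewrite p1; lra.
by rewrite /sqdist /tcomp /ncomp; ring.
Qed.

Lemma frame_sqr z : ncomp z ^+ 2 + tcomp z ^+ 2 = z.1 ^+ 2 + z.2 ^+ 2.
Proof.
suff: ncomp z ^+ 2 + tcomp z ^+ 2 - (z.1 ^+ 2 + z.2 ^+ 2) =
  (p.1 ^+ 2 + p.2 ^+ 2 - 1) * (z.1 ^+ 2 + z.2 ^+ 2) by rewrite p1; lra.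
by rewrite /tcomp /ncomp; ring.
Qed.

(** The pole is at distance eps from the closed disc. *)
Lemma sqdist_ge z : @cdisc R z -> eps ^+ 2 <= sqdist z.
Proof.
rewrite /cdisc/= -frame_sqr sqdist_frame => h; have := eps_gt0.
have : ncomp z <= 1 by have := sqr_ge0 (tcomp z); nra.
by rewrite /kap; have := sqr_ge0 (tcomp z); nra.
Qed.

Lemma sqdist_gt0 z : @cdisc R z -> 0 < sqdist z.
Proof. by move/sqdist_ge; apply: lt_le_trans; rewrite exprn_gt0// eps_gt0. Qed.

Lemma sqdist_lt z : @cdisc R z -> sqdist z < 16.
Proof.
rewrite /cdisc/= -frame_sqr sqdist_frame => h; have e0 := eps_gt0; have e1 := eps_le1.
have [? ?] : -1 <= ncomp z /\ ncomp z <= 1.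
  by have := sqr_ge0 (tcomp z); split; nra.
by rewrite /kap; nra.
Qed.

(** The side starts at 8 because the disc lies at distance less than 4 from the
    pole. *)
Definition pole_square (k : nat) : set (R * R) :=
  `[(kap * p.1 - 4 * 2^-1 ^+ k), (kap * p.1 + 4 * 2^-1 ^+ k)]%classic `*`
  `[(kap * p.2 - 4 * 2^-1 ^+ k), (kap * p.2 + 4 * 2^-1 ^+ k)]%classic.

Lemma pole_square_measurable k : measurable2 (pole_square k).
Proof. by apply: measurableX; exact: measurable_itv. Qed.

Lemma leb2_pole_square k : leb2 (pole_square k) = (64 * 4^-1 ^+ k)%:E.
Proof.
rewrite leb2_square ?mulr_ge0 ?exprn_ge0//; congr EFin.
by rewrite exprMn -exprM mulnC exprM mulrA; congr (_ * _ ^+ k); [ring|field].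
Qed.

Lemma leb2_pole_square_le k : (leb2 (pole_square k) <= (64 * 4^-1 ^+ k)%:E)%E.
Proof. by rewrite leb2_pole_square. Qed.

Lemma in_pole_square k z : sqdist z <= 16 * 4^-1 ^+ k -> pole_square k z.
Proof.
rewrite /sqdist /pole_square => h.
have h0 : 0 < 2^-1 ^+ k :> R by rewrite exprn_gt0.
have E : 16 * 4^-1 ^+ k = (4 * 2^-1 ^+ k) ^+ 2 :> R.
  by rewrite exprMn -exprM mulnC exprM; congr (_ * _ ^+ k); [ring|field].
move: h; rewrite E => h.
have h1 := sqr_ge0 (z.1 - kap * p.1); have h2 := sqr_ge0 (z.2 - kap * p.2).
(* the sup norm is at most the Euclidean one *)
have aux (x e : R) : 0 < e -> x ^+ 2 <= e ^+ 2 -> - e <= x <= e.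
  by move=> e0 xe; apply/andP; split; nra.
set e := 4 * 2^-1 ^+ k in h *.
have e0 : 0 < e by rewrite mulr_gt0.
have := aux (z.1 - kap * p.1) e e0 ltac:(lra).
have := aux (z.2 - kap * p.2) e e0 ltac:(lra).
by move=> a2 a1; split; rewrite /= in_itv/=; lra.
Qed.

(** If k is the last index such that sqdist z < 16 * 4^-k, then the k-th term alone
    dominates, as sqdist z >= 4 * 4^-k. *)
Lemma dyadic_le j m z : sqdist z < 16 -> 16 * 4^-1 ^+ m <= sqdist z ->
  (sqdist z)^-1 ^+ j <= \sum_(k < m) (4 ^+ k / 4) ^+ j * \1_(pole_square k) z.
Proof.
move=> N16; elim: m => [|m IH]; first by rewrite expr0 mulr1 leNgt N16.
move=> Nm; rewrite big_ord_recr/=.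
have c0 k : 0 <= (4 ^+ k / 4) ^+ j * \1_(pole_square k) z :> R.
  by rewrite mulr_ge0// exprn_ge0// divr_ge0// exprn_ge0.
have [h|h] := leP (16 * 4^-1 ^+ m) (sqdist z).
  by rewrite (le_trans (IH h))// lerDl.
have Bz : pole_square m z by apply: in_pole_square; exact: ltW.
rewrite [X in _ <= _ + _ * X]indicE mem_set// mulr1.
rewrite -[leLHS]add0r lerD ?sumr_ge0// ?lerXn2r// ?nnegrE ?invr_ge0 ?divr_ge0 ?exprn_ge0//.
  by apply: le_trans Nm; rewrite mulr_ge0// exprn_ge0.
have N0 : 0 < sqdist z by apply: lt_le_trans Nm; rewrite mulr_gt0// exprn_gt0.
rewrite -[leRHS]invrK lef_pV2 ?posrE// ?invr_gt0 ?divr_gt0 ?exprn_gt0//.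
apply: le_trans Nm; rewrite exprS invf_div exprVn.
rewrite le_eqVlt; apply/orP; left; apply/eqP; field.
by rewrite expf_neq0.
Qed.

Lemma eps2E : 16 * 4^-1 ^+ n.+2 = eps ^+ 2.
Proof.
have -> : eps ^+ 2 = 4^-1 ^+ n.
  by rewrite /eps -exprM mulnC exprM; congr (_ ^+ n); field.
by rewrite !exprS; field.
Qed.

Lemma dyadic_disc j z : @disc R z ->
  (sqdist z)^-1 ^+ j <= \sum_(k < n.+2) (4 ^+ k / 4) ^+ j * \1_(pole_square k) z.
Proof.
move=> /disc_cdisc Dz; apply: dyadic_le; first exact: sqdist_lt.
by rewrite eps2E; exact: sqdist_ge.
Qed.

Lemma sqdist_continuous : continuous sqdist.
Proof.
move=> z; apply: cvgD.
  have c1 : {for z, continuous (fun z : R * R => z.1 - kap * p.1)}.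
    by apply: cvgB; [exact: cvg_fst|exact: cvg_cst].
  exact: (cvgM c1 c1).
have c2 : {for z, continuous (fun z : R * R => z.2 - kap * p.2)}.
  by apply: cvgB; [exact: cvg_snd|exact: cvg_cst].
exact: (cvgM c2 c2).
Qed.

Lemma sqdistV_measurable j : measurable_fun2 (@disc R) (fun z => (sqdist z)^-1 ^+ j).
Proof.
apply: wcont_measurable_disc; apply: continuous_in_subspaceT => z /set_mem Dz.
apply: (@continuous_comp _ _ _ (fun z => (sqdist z)^-1) (fun s => s ^+ j)); last exact: exprn_continuous.
by apply: cvgV; [rewrite gt_eqF// sqdist_gt0|exact: sqdist_continuous].
Qed.

(** Every dyadic scale contributes the same amount 16; this is the logarithmic
    divergence of the energy of log |z - q|. *)
Lemma int_sqdistV :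
  (\int[@leb2 R]_(z in @disc R) ((sqdist z)^-1)%:E <= (16 * n.+2%:R)%:E)%E.
Proof.
have := @step_int _ _ _ (@leb2 R) (@disc R) (fun z => (sqdist z)^-1 ^+ 1) n.+2
   (fun k => (4 ^+ k / 4) ^+ 1) (fun k => 64 * 4^-1 ^+ k) pole_square
   (@measurable_disc R) (sqdistV_measurable 1).
have -> : \sum_(k < n.+2) (4 ^+ k / 4) ^+ 1 * (64 * 4^-1 ^+ k) = 16 * n.+2%:R :> R.
  under eq_bigr => k _.
    have -> : (4 ^+ k / 4) ^+ 1 * (64 * 4^-1 ^+ k) = 16 :> R.
      by rewrite expr1 exprVn; field; rewrite expf_neq0.
    over.
  by rewrite sumr_const card_ord mulr_natr.
apply.
- by move=> z /disc_cdisc/sqdist_gt0 N0; rewrite exprn_ge0// invr_ge0 ltW.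
- by move=> k; rewrite exprn_ge0// divr_ge0// exprn_ge0.
- exact: pole_square_measurable.
- exact: leb2_pole_square_le.
- by move=> z Dz; exact: dyadic_disc.
Qed.

(** Here the contributions form a geometric sum, dominated by the scale eps. *)
Lemma int_sqdistV2 :
  (\int[@leb2 R]_(z in @disc R) ((sqdist z)^-1 ^+ 2)%:E <= (64 * 4 ^+ n)%:E)%E.
Proof.
apply: (@le_trans _ _ (\sum_(k < n.+2) (4 ^+ k / 4) ^+ 2 * (64 * 4^-1 ^+ k))%:E).
  apply: (@step_int _ _ _ (@leb2 R) (@disc R) (fun z => (sqdist z)^-1 ^+ 2) n.+2
    (fun k => (4 ^+ k / 4) ^+ 2) (fun k => 64 * 4^-1 ^+ k) pole_square).
  - exact: measurable_disc.
  - exact: sqdistV_measurable.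
  - by move=> z /disc_cdisc/sqdist_gt0 N0; rewrite exprn_ge0// invr_ge0 ltW.
  - by move=> k; rewrite exprn_ge0// divr_ge0// exprn_ge0.
  - exact: pole_square_measurable.
  - exact: leb2_pole_square_le.
  - by move=> z Dz; exact: dyadic_disc.
rewrite lee_fin; under eq_bigr => k _.
  have -> : (4 ^+ k / 4) ^+ 2 * (64 * 4^-1 ^+ k) = 4 * 4 ^+ k :> R.
    by rewrite exprVn; field; rewrite expf_neq0.
  over.
rewrite -mulr_sumr; have := @sum_expr_le R 4 n.+2 ltac:(lra).
by rewrite !exprS; lra.
Qed.

End Dyadic.

(** * The vector fields and their Lorentz norm *)

Section Field.
Context {R : realType}.
Variables (p : R * R) (n : nat).
Hypothesis p1 : p.1 ^+ 2 + p.2 ^+ 2 = 1.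
Notation eps := (@eps R n).
Notation kap := (@kap R n).
Notation sqdist := (@sqdist R p n).

Definition off_pole : set (R * R) := [set z | 0 < sqdist z].

Lemma cdisc_off_pole : @cdisc R `<=` off_pole.
Proof. by move=> z; exact: sqdist_gt0. Qed.

Definition dx (z : R * R) := z.1 - kap * p.1.
Definition dy (z : R * R) := z.2 - kap * p.2.

Lemma isgrad_dx z : isgrad dx z 1 0.
Proof.
apply: isgrad_eq; first exact: (isgradD (isgrad_fst z) (isgrad_cst (- (kap * p.1)) z)).
  by rewrite addr0.
by rewrite addr0.
Qed.

Lemma isgrad_dy z : isgrad dy z 0 1.
Proof.
apply: isgrad_eq; first exact: (isgradD (isgrad_snd z) (isgrad_cst (- (kap * p.2)) z)).
  by rewrite addr0.
by rewrite addr0.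
Qed.

Lemma sqdistE : sqdist = fun z => dx z * dx z + dy z * dy z.
Proof. by apply/funext => z; rewrite /sqdist -!expr2. Qed.

Lemma isgrad_sqdist z : isgrad sqdist z (2 * dx z) (2 * dy z).
Proof.
rewrite sqdistE; apply: isgrad_eq.
- by apply: isgradD; apply: isgradM; (exact: isgrad_dx || exact: isgrad_dy).
- by ring.
- by ring.
Qed.

Lemma isgrad_sqdistV z : off_pole z ->
  isgrad (fun z => (sqdist z)^-1) z (- (2 * dx z) / sqdist z ^+ 2) (- (2 * dy z) / sqdist z ^+ 2).
Proof.
rewrite /off_pole/= => N0; have Nn : sqdist z != 0 by rewrite gt_eqF.
apply: isgrad_eq.
- apply: isgrad_comp; first exact: isgrad_sqdist.
  by apply: is_deriveV.
- by rewrite /GRing.scale/=; field.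
- by rewrite /GRing.scale/=; field.
Qed.

(** Va + i Vb is the holomorphic function eps / (z - q), so that the Jacobian is the
    square of the modulus of its derivative. *)
Definition Va z := eps * dx z * (sqdist z)^-1.
Definition Vb z := - eps * dy z * (sqdist z)^-1.

Lemma isgrad_Va z : off_pole z -> isgrad Va z (eps * (dy z ^+ 2 - dx z ^+ 2) / sqdist z ^+ 2)
   (- 2 * eps * dx z * dy z / sqdist z ^+ 2).
Proof.
rewrite /off_pole => N0; apply: isgrad_eq.
- apply: isgradM; last exact: isgrad_sqdistV.
  by apply: isgradM; [exact: isgrad_cst|exact: isgrad_dx].
- have := N0; rewrite sqdistE /= => ?; field; by rewrite gt_eqF.
- have := N0; rewrite sqdistE /= => ?; field; by rewrite gt_eqF.
Qed.

Lemma isgrad_Vb z : off_pole z -> isgrad Vb z (2 * eps * dx z * dy z / sqdist z ^+ 2)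
   (eps * (dy z ^+ 2 - dx z ^+ 2) / sqdist z ^+ 2).
Proof.
rewrite /off_pole => N0; apply: isgrad_eq.
- apply: isgradM; last exact: isgrad_sqdistV.
  by apply: isgradM; [exact: isgrad_cst|exact: isgrad_dy].
- have := N0; rewrite sqdistE /= => ?; field; by rewrite gt_eqF.
- have := N0; rewrite sqdistE /= => ?; field; by rewrite gt_eqF.
Qed.

Lemma jacV z : off_pole z -> jac Va Vb z = eps ^+ 2 / sqdist z ^+ 2.
Proof.
move=> Uz; rewrite /jac (isgrad_d1 (isgrad_Va Uz)) (isgrad_d2 (isgrad_Va Uz)).
rewrite (isgrad_d1 (isgrad_Vb Uz)) (isgrad_d2 (isgrad_Vb Uz)).
by move: Uz; rewrite /off_pole sqdistE /= => ?; field; rewrite gt_eqF.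
Qed.

Lemma grad_normV z : off_pole z -> grad_norm Va Vb z = Num.sqrt 2 * eps / sqdist z.
Proof.
move=> Uz; rewrite /grad_norm (isgrad_d1 (isgrad_Va Uz)) (isgrad_d2 (isgrad_Va Uz)).
rewrite (isgrad_d1 (isgrad_Vb Uz)) (isgrad_d2 (isgrad_Vb Uz)).
have e0 : 0 <= eps / sqdist z by rewrite divr_ge0// ltW// eps_gt0.
rewrite -[RHS]mulrA -[in RHS](ger0_norm e0) -sqrtr_sqr -sqrtrM//; congr Num.sqrt.
by move: Uz; rewrite /off_pole sqdistE /= => ?; field; rewrite gt_eqF.
Qed.

Lemma Cinfty_V : Cinfty Va /\ Cinfty Vb.
Proof.
have cdx k : Ckon off_pole k dx by apply: CkonD; [exact: Ckon_fst|exact: Ckon_cst].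
have cdy k : Ckon off_pole k dy by apply: CkonD; [exact: Ckon_snd|exact: Ckon_cst].
have cNV k : Ckon off_pole k (fun z => (sqdist z)^-1).
  apply: CkonV; first by move=> z N0; rewrite gt_eqF.
  by rewrite sqdistE; apply: CkonD; exact: CkonM.
by split => k; apply: (Ckon_Ck cdisc_off_pole); apply: CkonM => //; apply: CkonM => //; exact: Ckon_cst.
Qed.

Local Notation gV := (grad_norm Va Vb).
Local Notation s2 := (Num.sqrt 2 : R).

Lemma s2_gt0 : 0 < s2. Proof. by rewrite sqrtr_gt0. Qed.
Lemma s2_le2 : s2 <= 2.
Proof. have := sqr_sqrtr (ler0n R 2); have := s2_gt0; nra. Qed.

(** For t above level k the gradient norm exceeds t only inside the k-th dyadic
    square around the pole. *)
Definition level (k : nat) : R := s2 * eps * 4 ^+ k / 16.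

Lemma level_ge0 k : 0 <= level k.
Proof. by rewrite divr_ge0// mulr_ge0 ?exprn_ge0// mulr_ge0 ?ltW ?s2_gt0 ?eps_gt0. Qed.

Lemma level_sqdist k t z : @disc R z -> level k <= t -> t < `|gV z| -> sqdist z < 16 * 4^-1 ^+ k.
Proof.
move=> Dz kt; have Uz := cdisc_off_pole (disc_cdisc Dz).
rewrite (grad_normV Uz).
have se : 0 < s2 * eps by rewrite mulr_gt0 ?s2_gt0 ?eps_gt0.
rewrite ger0_norm ?divr_ge0// ?ltW// => tN.
have := le_lt_trans kt tN; rewrite /level -[X in X < _]mulrA ltr_pM2l//.
rewrite -[X in _ < X]invrK; set y := 4 ^+ k / 16.
have y0 : 0 < y by rewrite divr_gt0// exprn_gt0.
rewrite invrK -[X in X < _]invrK ltf_pV2 ?posrE ?invr_gt0// => /lt_le_trans; apply.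
by rewrite /y invf_div exprVn.
Qed.

Definition superlevel t := @disc R `&` [set z | t < `|gV z|].

Lemma superlevel_measurable t : measurable2 (superlevel t).
Proof.
have mg : measurable_fun2 (@disc R) (fun z => s2 * eps * (sqdist z)^-1 ^+ 1).
  by apply: measurable_funM; [exact: measurable_cst|exact: sqdistV_measurable].
have := mg (@measurable_disc R) `]t, +oo[%classic (measurable_itv _).
congr (measurable2 _); apply/seteqP; split => z /= [Dz];
  have Uz := cdisc_off_pole (disc_cdisc Dz); have se : 0 < s2 * eps by rewrite mulr_gt0 ?s2_gt0 ?eps_gt0.
  rewrite in_itv/= andbT expr1 => h; split => //=.
  by rewrite (grad_normV Uz) ger0_norm// divr_ge0// ltW.
move=> /= h; split => //; move: h.
by rewrite in_itv/= andbT expr1 (grad_normV Uz) ger0_norm// divr_ge0// ltW.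
Qed.

Lemma dist_le4 t : (distribution_fun gV t <= 4%:E)%E.
Proof.
apply: le_trans (@leb2_disc_le R); apply: le_measure; rewrite ?inE.
- exact: superlevel_measurable.
- exact: measurable_disc.
- by move=> z [].
Qed.

Lemma dist_ge0 t : (0 <= distribution_fun gV t)%E.
Proof. by rewrite /distribution_fun; exact: measure_ge0. Qed.

Lemma dist_fin t : distribution_fun gV t = (fine (distribution_fun gV t))%:E.
Proof.
rewrite fineK// ge0_fin_numE ?dist_ge0//.
exact: le_lt_trans (dist_le4 t) (ltry _).
Qed.

Lemma dist_level k t : level k <= t -> fine (distribution_fun gV t) <= 64 * 4^-1 ^+ k.
Proof.
move=> kt; rewrite -lee_fin -dist_fin; apply: le_trans (leb2_pole_square_le p n k).
apply: le_measure; rewrite ?inE.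
- exact: superlevel_measurable.
- exact: pole_square_measurable.
- by move=> z [Dz /= tz]; apply: in_pole_square; apply/ltW/(level_sqdist Dz kt).
Qed.

Lemma dist_top t : level n.+2 <= t -> fine (distribution_fun gV t) = 0.
Proof.
move=> kt; rewrite /distribution_fun -/(superlevel t).
have -> : superlevel t = set0.
  apply/seteqP; split => // z [Dz /= tz].
  have := level_sqdist Dz kt tz; rewrite eps2E.
  by rewrite ltNge (@sqdist_ge R p n p1 z (disc_cdisc Dz)).
by have -> : leb2 (set0 : set (R * R)) = 0%E by exact: measure0.
Qed.

Definition sdist t := Num.sqrt (fine (distribution_fun gV t)).

Lemma sdist_level k t : level k <= t -> sdist t <= 8 * 2^-1 ^+ k.
Proof.
move=> kt; have h0 : 0 <= 8 * 2^-1 ^+ k :> R by rewrite mulr_ge0// exprn_ge0.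
rewrite -(ger0_norm h0) -sqrtr_sqr ler_wsqrtr// (le_trans (dist_level kt))//.
rewrite exprMn -exprM mulnC exprM.
have -> : 2^-1 ^+ 2 = 4^-1 :> R by field.
by have : 0 <= 4^-1 ^+ k :> R by [rewrite exprn_ge0]; lra.
Qed.

Lemma sdist_le8 t : sdist t <= 8.
Proof.
have -> : 8 = Num.sqrt (8 ^+ 2) :> R by rewrite sqrtr_sqr ger0_norm.
rewrite /sdist ler_wsqrtr// -lee_fin -dist_fin (le_trans (dist_le4 t))// lee_fin; lra.
Qed.

Lemma sdist_step t : 0 <= t ->
  sdist t <= \sum_(k < n.+2) (8 * 2^-1 ^+ k) * \1_(`[0, level k.+1]%classic) t.
Proof.
move=> t0.
have c0 k : 0 <= (8 * 2^-1 ^+ k) * \1_(`[0, level k.+1]%classic) t.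
  by rewrite mulr_ge0// mulr_ge0// exprn_ge0.
have [/dist_top h|] := leP (level n.+2) t.
  by rewrite /sdist h sqrtr0 sumr_ge0.
elim: n.+1 => [|m IH] tm.
  rewrite big_ord_recr big_ord0/= add0r expr0 mulr1 indicE mem_set ?mulr1 ?sdist_le8//=.
  by rewrite in_itv/= t0 ltW.
rewrite big_ord_recr/=; have [mt|/IH h] := leP (level m.+1) t.
  rewrite -[leLHS]add0r lerD ?sumr_ge0//.
  rewrite indicE mem_set ?mulr1 ?sdist_level//=.
  by rewrite in_itv/= t0 ltW.
by rewrite (le_trans h)// lerDl.
Qed.

Lemma sdist_nincr s t : s <= t -> sdist t <= sdist s.
Proof.
move=> st; apply: ler_wsqrtr; rewrite -lee_fin -!dist_fin.
apply: le_measure; rewrite ?inE; [exact: superlevel_measurable..|].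
by move=> z [Dz /= tz]; split => //=; exact: le_lt_trans st tz.
Qed.

(** The levels between 0 and sqrt 2 / eps are cut dyadically.  The square root of
    the area of the k-th square is proportional to 2^-k while the level is
    proportional to eps 4^k; the products form a geometric sum dominated by its
    last term, which is of order 1. *)
Lemma lorentzV : (lorentz21 gV <= 32%:E)%E.
Proof.
rewrite /lorentz21.
have -> : 32%:E = (2%:E * 16%:E)%E :> \bar R by rewrite -EFinM; congr EFin; ring.
rewrite lee_wpmul2l ?lee_fin//.
under eq_integral => t _.
  have -> : (distribution_fun gV t `^ 2^-1)%E = (sdist t)%:E.
    by rewrite dist_fin poweR_EFin powR12_sqrt// fine_ge0//; exact: dist_ge0.
  over.
apply: (@le_trans _ _ (\sum_(k < n.+2) (8 * 2^-1 ^+ k) * level k.+1)%:E).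
  apply: (@step_int _ _ _ (@lebesgue_measure R) `[0, +oo[%classic sdist n.+2
    (fun k => 8 * 2^-1 ^+ k) (fun k => level k.+1) (fun k => `[0, level k.+1]%classic)).
  - exact: measurable_itv.
  - by apply: nonincreasing_measurable; [exact: measurable_itv|move=> s t; exact: sdist_nincr].
  - by move=> t _; exact: sqrtr_ge0.
  - by move=> k; rewrite mulr_ge0// exprn_ge0.
  - by move=> k; exact: measurable_itv.
  - move=> k.
    have E : (@lebesgue_measure R `[0%R, level k.+1]%classic <= (level k.+1)%:E)%E.
      rewrite lebesgue_measure_itv/= lte_fin.
      by case: ifPn => _; rewrite ?sube0 ?lee_fin ?level_ge0.
    exact: E.
  - by move=> t; rewrite /= in_itv/= andbT; exact: sdist_step.
rewrite lee_fin.
under eq_bigr => k _.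
  have -> : 8 * 2^-1 ^+ k * level k.+1 = 2 * s2 * eps * 2 ^+ k :> R.
    rewrite /level exprVn exprS.
    have -> : 4 ^+ k = 2 ^+ k * 2 ^+ k :> R.
      by rewrite -exprMn; congr (_ ^+ _); ring.
    by field; rewrite expf_neq0.
  over.
rewrite -mulr_sumr.
have h := @sum_expr_le R 2 n.+2 (lexx _).
have e2 : eps * 2 ^+ n = 1 by rewrite /eps -exprMn mulVf ?expr1n.
have s0 := s2_gt0; have s2l := s2_le2; have e0 := @eps_gt0 R n.
apply: (@le_trans _ _ (2 * s2 * eps * 2 ^+ n.+2)).
  by rewrite ler_wpM2l// !mulr_ge0// ltW.
have -> : 2 * s2 * eps * 2 ^+ n.+2 = 8 * s2 * (eps * 2 ^+ n) by rewrite !exprS; ring.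
by rewrite e2; lra.
Qed.

End Field.

(** * The test function *)

Lemma normM_le (R : realDomainType) (a b A B : R) :
  `|a| <= A -> `|b| <= B -> `|a * b| <= A * B.
Proof. by move=> aA bB; rewrite normrM ler_pM. Qed.

Lemma normD_le (R : realDomainType) (a b A B : R) :
  `|a| <= A -> `|b| <= B -> `|a + b| <= A + B.
Proof. by move=> aA bB; rewrite (le_trans (ler_normD _ _))// lerD. Qed.

Section Test.
Context {R : realType}.
Variables (p : R * R) (n : nat) (rho : R).
Hypothesis p1 : p.1 ^+ 2 + p.2 ^+ 2 = 1.
Hypothesis rho0 : 0 < rho.
Hypothesis rho1 : rho <= 1.
Notation eps := (@eps R n).
Notation kap := (@kap R n).
Notation sqdist := (@sqdist R p n).
Notation off_pole := (@off_pole R p n).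
Notation dx := (@dx R p n).
Notation dy := (@dy R p n).
Notation S := (ncomp p).
Notation T := (tcomp p).

Definition logq z := ln ((sqdist z)^-1 * rho ^+ 2).
Definition theta z := ramp 5 2 (logq z).
(** First and second derivatives of the cut-off [ramp 5 2], evaluated at logq. *)
Definition theta1 z := 5 * ramp 4 2 (logq z) + - 4 * ramp 6 3 (logq z).
Definition theta2 z := 20 * ramp 3 2 (logq z) + - 44 * ramp 5 3 (logq z) + 24 * ramp 7 4 (logq z).
(** The tangential primitive of the test function.  The factor T compensates one
    power of the distance to the pole, so the gradient of Hfun is no larger than
    a logarithm. *)
Definition Hfun z := T z * theta z.
(** The angular derivative z.1 d2 - z.2 d1 of Hfun; its main part is S theta, and the
    correction term is bounded. *)
Definition psi z := S z * theta z + - (2 * kap) * T z * T z * theta1 z * (sqdist z)^-1.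

Lemma kap_le2 : 0 < kap <= 2.
Proof. by have := @eps_gt0 R n; have := @eps_le1 R n; rewrite /kap; lra. Qed.

Lemma isgrad_S z : isgrad S z p.1 p.2.
Proof.
apply: isgrad_eq.
- by apply: isgradD; apply: isgradM; (exact: isgrad_cst || exact: isgrad_fst || exact: isgrad_snd).
- by rewrite /=; ring.
- by rewrite /=; ring.
Qed.

Lemma isgrad_T z : isgrad T z (- p.2) p.1.
Proof.
rewrite (_ : T = fun z => p.1 * z.2 + - p.2 * z.1); last first.
  by apply/funext => w; rewrite /tcomp mulNr.
apply: isgrad_eq.
- by apply: isgradD; apply: isgradM; (exact: isgrad_cst || exact: isgrad_fst || exact: isgrad_snd).
- by rewrite /=; ring.
- by rewrite /=; ring.
Qed.

Lemma isgrad_logq z : off_pole z -> isgrad logq z (- 2 * dx z / sqdist z) (- 2 * dy z / sqdist z).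
Proof.
move=> Uz; have N0 : 0 < sqdist z by [].
have h : 0 < (sqdist z)^-1 * rho ^+ 2 by rewrite mulr_gt0 ?invr_gt0 ?exprn_gt0.
apply: isgrad_eq.
- apply: isgrad_comp; last exact: is_derive1_ln h.
  by apply: isgradM; [exact: isgrad_sqdistV|exact: isgrad_cst].
- by rewrite /=; field; rewrite !gt_eqF.
- by rewrite /=; field; rewrite !gt_eqF.
Qed.

Lemma isgrad_ramp a b z : off_pole z -> isgrad (fun z => ramp a.+2 b (logq z)) z
  ((a.+2%:R * ramp a.+1 b (logq z) - 2 * b%:R * ramp a.+3 b.+1 (logq z)) * (- 2 * dx z / sqdist z))
  ((a.+2%:R * ramp a.+1 b (logq z) - 2 * b%:R * ramp a.+3 b.+1 (logq z)) * (- 2 * dy z / sqdist z)).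
Proof. by move=> Uz; apply: isgrad_comp; [exact: isgrad_logq|exact: is_derive_ramp]. Qed.

Lemma isgrad_theta z : off_pole z -> isgrad theta z (theta1 z * (- 2 * dx z / sqdist z)) (theta1 z * (- 2 * dy z / sqdist z)).
Proof.
move=> Uz; apply: isgrad_eq; first exact: isgrad_ramp.
  by rewrite /theta1; ring.
by rewrite /theta1; ring.
Qed.

Lemma isgrad_theta1 z : off_pole z -> isgrad theta1 z (theta2 z * (- 2 * dx z / sqdist z)) (theta2 z * (- 2 * dy z / sqdist z)).
Proof.
move=> Uz; apply: isgrad_eq.
- by apply: isgradD; apply: isgradM; (exact: isgrad_cst || exact: isgrad_ramp).
- by rewrite /= /theta2; ring.
- by rewrite /= /theta2; ring.
Qed.

Definition Hfun1 z := - p.2 * theta z + T z * (theta1 z * (- 2 * dx z / sqdist z)).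
Definition Hfun2 z := p.1 * theta z + T z * (theta1 z * (- 2 * dy z / sqdist z)).

Lemma isgrad_Hfun z : off_pole z -> isgrad Hfun z (Hfun1 z) (Hfun2 z).
Proof. by move=> Uz; apply: isgradM; [exact: isgrad_T|exact: isgrad_theta]. Qed.

Definition psi1 z := p.1 * theta z - 2 * S z * theta1 z * (dx z / sqdist z)
  - 2 * kap * (- 2 * p.2 * theta1 z * (T z / sqdist z)
    - 2 * (T z ^+ 2 / sqdist z) * (theta2 z + theta1 z) * (dx z / sqdist z)).
Definition psi2 z := p.2 * theta z - 2 * S z * theta1 z * (dy z / sqdist z)
  - 2 * kap * (2 * p.1 * theta1 z * (T z / sqdist z)
    - 2 * (T z ^+ 2 / sqdist z) * (theta2 z + theta1 z) * (dy z / sqdist z)).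

Lemma isgrad_psi z : off_pole z -> isgrad psi z (psi1 z) (psi2 z).
Proof.
move=> Uz; have N0 : sqdist z != 0 by rewrite gt_eqF.
apply: isgrad_eq.
- apply: isgradD; first by apply: isgradM; [exact: isgrad_S|exact: isgrad_theta].
  apply: isgradM; last exact: isgrad_sqdistV.
  apply: isgradM; last exact: isgrad_theta1.
  apply: isgradM; last exact: isgrad_T.
  by apply: isgradM; [exact: isgrad_cst|exact: isgrad_T].
- by rewrite /= /psi1; field.
- by rewrite /= /psi2; field.
Qed.

(** This turns the zeroth order boundary term of the weak formulation into a pairing
    of the trace with a tangential derivative. *)
Lemma dtau_Hfun t : dtau Hfun t = psi (circle_pt t).
Proof.
have Uz := @cdisc_off_pole R p n p1 _ (circle_pt_cdisc t).
rewrite /dtau derive1E; have h := isgrad_circle (isgrad_Hfun Uz).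
rewrite (@derive_val _ _ _ _ _ _ _ h) /psi /Hfun1 /Hfun2 /ncomp /tcomp /dx /dy /=.
by field; rewrite gt_eqF.
Qed.

Lemma C2on_logq : C2on off_pole logq.
Proof.
have cN : C2on off_pole sqdist.
  rewrite sqdistE; apply: C2onD; apply: C2onM; apply: C2onD; (exact: C2on_cst || exact: C2on_fst || exact: C2on_snd).
apply: C2on_ln.
  by move=> z Uz; rewrite mulr_gt0 ?invr_gt0 ?exprn_gt0.
by apply: C2onM; [exact: C2on_inv|exact: C2on_cst].
Qed.

Lemma C2on_tcomp : C2on off_pole T.
Proof.
rewrite (_ : T = fun z => p.1 * z.2 + - p.2 * z.1); last first.
  by apply/funext => w; rewrite /tcomp mulNr.
by apply: C2onD; apply: C2onM; (exact: C2on_cst || exact: C2on_fst || exact: C2on_snd).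
Qed.

Lemma C2on_Hfun : C2on off_pole Hfun.
Proof. by apply: C2onM; [exact: C2on_tcomp|apply: C2on_ramp; exact: C2on_logq]. Qed.

Lemma C2on_psi : C2on off_pole psi.
Proof.
have cL := C2on_logq; have cT := C2on_tcomp.
have cN : C2on off_pole sqdist.
  rewrite sqdistE; apply: C2onD; apply: C2onM; apply: C2onD; (exact: C2on_cst || exact: C2on_fst || exact: C2on_snd).
have cS : C2on off_pole S.
  by apply: C2onD; apply: C2onM; (exact: C2on_cst || exact: C2on_fst || exact: C2on_snd).
apply: C2onD; first by apply: C2onM => //; exact: C2on_ramp.
apply: C2onM; last exact: C2on_inv.
apply: C2onM.
  by do 2!(apply: C2onM => //); exact: C2on_cst.
by apply: C2onD; apply: C2onM; (exact: C2on_cst || exact: C2on_ramp).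
Qed.

Lemma norm_ramp a b s : (a <= b.*2)%N -> `|ramp a b s : R| <= 1.
Proof. by move=> ab; rewrite ger0_norm ?ramp_ge0// ramp_le1. Qed.

Lemma theta1_le z : `|theta1 z| <= 9.
Proof.
rewrite (_ : 9 = 5 * 1 + 4 * 1 :> R); last ring.
by apply: normD_le; apply: normM_le; rewrite ?norm_ramp// ?normrN ger0_norm.
Qed.

Lemma theta2_le z : `|theta2 z| <= 88.
Proof.
rewrite (_ : 88 = 20 * 1 + 44 * 1 + 24 * 1 :> R); last ring.
by do 2?apply: normD_le; apply: normM_le; rewrite ?norm_ramp// ?normrN ger0_norm.
Qed.

Lemma theta_ge0 z : 0 <= theta z.
Proof. exact: ramp_ge0. Qed.

(** The inverse of the distance to the pole: the size of the gradients below. *)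
Definition invdist z := Num.sqrt ((sqdist z)^-1).

Section At.
Variables (z : R * R).
Hypothesis Dz : @cdisc R z.

Let N0 : 0 < sqdist z. Proof. exact: sqdist_gt0. Qed.

Lemma invdist_sqr : invdist z ^+ 2 = (sqdist z)^-1.
Proof. by rewrite sqr_sqrtr// invr_ge0 ltW. Qed.

Lemma invdist_gt0 : 0 < invdist z.
Proof. by rewrite sqrtr_gt0 invr_gt0. Qed.

Lemma invdist_ge : 1 <= 4 * invdist z.
Proof.
have m0 := invdist_gt0; have := invdist_sqr => m2.
have : 16^-1 < invdist z ^+ 2.
  by rewrite m2 ltf_pV2 ?posrE//; exact: sqdist_lt.
nra.
Qed.

Lemma invdist_norm x : x ^+ 2 <= sqdist z -> `|x * invdist z| <= 1.
Proof.
move=> xN; have : (x * invdist z) ^+ 2 <= 1.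
  by rewrite exprMn invdist_sqr ler_pdivrMr// mul1r.
by rewrite -real_normK ?num_real//; have := normr_ge0 (x * invdist z); nra.
Qed.

Lemma dx_le : `|dx z * invdist z| <= 1.
Proof. by apply: invdist_norm; rewrite /sqdist lerDl sqr_ge0. Qed.

Lemma dy_le : `|dy z * invdist z| <= 1.
Proof. by apply: invdist_norm; rewrite /sqdist lerDr sqr_ge0. Qed.

Lemma T_le : `|T z * invdist z| <= 1.
Proof. by apply: invdist_norm; rewrite sqdist_frame// lerDl sqr_ge0. Qed.

Lemma S_le : `|S z| <= 1.
Proof.
have := Dz; rewrite /cdisc/= -(frame_sqr p1) => h.
by rewrite ler_norml; have := sqr_ge0 (T z) => h2; apply/andP; split; nra.
Qed.

(** The logarithm is estimated by [ln_sqr_le]: theta^2 <= 2 rho^2 / |z - q|^2. *)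
Lemma theta_le : theta z <= 2 * invdist z.
Proof.
have r0 : 0 < (sqdist z)^-1 * rho ^+ 2 by rewrite mulr_gt0 ?invr_gt0 ?exprn_gt0.
have h := ln_sqr_le r0; have h2 := ramp52_le (logq z).
have m0 := invdist_gt0; have := invdist_sqr => m2.
have rr : rho ^+ 2 <= 1 by rewrite exprn_ile1// ltW.
apply: (le_trans h2); rewrite -ler_sqr ?nnegrE ?mulr_ge0 ?(ltW m0)//; last first.
  by rewrite le_max lexx orbT.
apply: (le_trans h); rewrite exprMn m2.
have : 0 < (sqdist z)^-1 by rewrite invr_gt0.
nra.
Qed.

Lemma pi_le : `|p.1| <= 1 /\ `|p.2| <= 1.
Proof.
have h : p.1 ^+ 2 + p.2 ^+ 2 <= 1 by rewrite p1.
rewrite !ler_norml; split; first exact: sqr_le1 h.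
by apply: (@sqr_le1 _ _ p.1); rewrite addrC.
Qed.

Let divN x : x / sqdist z = (x * invdist z) * invdist z.
Proof. by rewrite -mulrA -expr2 invdist_sqr. Qed.

Let abs_theta : `|theta z| <= 2 * invdist z.
Proof. by rewrite ger0_norm ?theta_ge0// theta_le. Qed.

Lemma Hfun_bound (a d : R) : `|a| <= 1 -> `|d * invdist z| <= 1 ->
  `|a * theta z + T z * (theta1 z * (- 2 * d / sqdist z))| <= 1000 * invdist z.
Proof.
move=> a1 d1; have m4 := invdist_ge; have m0 := invdist_gt0.
have E : T z * (theta1 z * (- 2 * d / sqdist z)) = (T z * invdist z) * (theta1 z * (- 2 * (d * invdist z))).
  by rewrite divN; ring.
apply: (@le_trans _ _ (1 * (2 * invdist z) + 1 * (9 * (2 * 1)))); last by lra.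
rewrite E; apply: normD_le; first exact: normM_le.
apply: normM_le; first exact: T_le.
apply: normM_le; first exact: theta1_le.
by apply: normM_le => //; rewrite normrN ger0_norm.
Qed.

Lemma Hfun1_le : `|Hfun1 z| <= 1000 * invdist z.
Proof. by apply: Hfun_bound; [rewrite normrN; case: pi_le|exact: dx_le]. Qed.

Lemma Hfun2_le : `|Hfun2 z| <= 1000 * invdist z.
Proof. by apply: Hfun_bound; [case: pi_le|exact: dy_le]. Qed.

(** Each occurrence of T or of d absorbs one factor 1 / |z - q|; exactly one such
    factor is left in every term. *)
Lemma psi_bound (a b d : R) : `|a| <= 1 -> `|b| <= 1 -> `|d * invdist z| <= 1 ->
  `|a * theta z - 2 * S z * theta1 z * (d / sqdist z)
  - 2 * kap * (2 * b * theta1 z * (T z / sqdist z)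
    - 2 * (T z ^+ 2 / sqdist z) * (theta2 z + theta1 z) * (d / sqdist z))| <= 1000 * invdist z.
Proof.
move=> a1 b1 d1; have m0 := invdist_gt0; have /andP[k0 k2] := kap_le2.
have n2 : `|2 : R| <= 2 by rewrite ger0_norm.
have nm : `|invdist z| <= invdist z by rewrite ger0_norm// ltW.
have nk : `|kap| <= 2 by rewrite ger0_norm// ltW.
apply: (@le_trans _ _ ((1 * (2 * invdist z) + 2 * 1 * 9 * 1 * invdist z) +
   2 * 2 * ((2 * 1 * 9 * 1 * invdist z) + 2 * 1 * 1 * (88 + 9) * 1 * invdist z))); last by lra.
have E : a * theta z - 2 * S z * theta1 z * (d / sqdist z)
  - 2 * kap * (2 * b * theta1 z * (T z / sqdist z)
    - 2 * (T z ^+ 2 / sqdist z) * (theta2 z + theta1 z) * (d / sqdist z)) =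
  (a * theta z + - (2 * S z * theta1 z * (d * invdist z) * invdist z)) +
  - (2 * kap * ((2 * b * theta1 z * (T z * invdist z) * invdist z) +
     - (2 * (T z * invdist z) * (T z * invdist z) * (theta2 z + theta1 z) * (d * invdist z) * invdist z))).
  by rewrite !divN; ring.
rewrite E; have tT := T_le; have tS := S_le; have t1 := theta1_le z; have t2 := theta2_le z.
apply: normD_le.
  by apply: normD_le; [exact: normM_le|rewrite normrN; do 4!(apply: normM_le => //)].
rewrite normrN; apply: normM_le; first exact: normM_le.
apply: normD_le; first by do 4!(apply: normM_le => //).
rewrite normrN; do 2!(apply: normM_le => //); apply: normM_le; last exact: normD_le.
by do 2!(apply: normM_le => //).
Qed.

Lemma psi1_le : `|psi1 z| <= 1000 * invdist z.
Proof.
have [? ?] := pi_le.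
rewrite /psi1 (_ : - 2 * p.2 = 2 * - p.2); last ring.
by apply: psi_bound; rewrite ?normrN//; exact: dx_le.
Qed.

Lemma psi2_le : `|psi2 z| <= 1000 * invdist z.
Proof. by have [? ?] := pi_le; apply: psi_bound => //; exact: dy_le. Qed.

Lemma logq_le0 : rho ^+ 2 <= sqdist z -> logq z <= 0.
Proof.
move=> h; apply: ln_le0; rewrite mulrC ler_pdivrMr// mul1r; exact: h.
Qed.

Lemma psi0 : rho ^+ 2 <= sqdist z -> psi z = 0.
Proof.
move=> /logq_le0 h.
have t0 : theta z = 0 by rewrite /theta ramp0.
have t1 : theta1 z = 0 by rewrite /theta1 !ramp0// !mulr0 addr0.
by rewrite /psi t0 t1 !mulr0 mul0r addr0.
Qed.

Lemma psi_correction_le : `|- (2 * kap) * T z * T z * theta1 z * (sqdist z)^-1| <= 36.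
Proof.
have /andP[k0 k2] := kap_le2.
have -> : - (2 * kap) * T z * T z * theta1 z * (sqdist z)^-1 =
  - (2 * kap) * (T z * invdist z) * (T z * invdist z) * theta1 z by rewrite -invdist_sqr; ring.
rewrite (_ : 36 = 2 * 2 * 1 * 1 * 9 :> R); last ring.
apply: normM_le; last exact: theta1_le.
do 2!(apply: normM_le; last exact: T_le).
by rewrite normrN; apply: normM_le; rewrite ger0_norm// ltW.
Qed.

(** Where theta is positive the distance to the pole is less than rho <= 1, hence
    S > 0 there and the main part of psi is nonnegative. *)
Lemma psi_ge : - 36 <= psi z.
Proof.
have := psi_correction_le; rewrite ler_norml => /andP[h _].
suff : 0 <= S z * theta z by rewrite /psi; lra.
have [NL|NL] := leP (rho ^+ 2) (sqdist z); first by rewrite /theta ramp0 ?mulr0// logq_le0.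
rewrite mulr_ge0 ?theta_ge0//.
have rr : rho ^+ 2 <= 1 by rewrite exprn_ile1// ltW.
have := @eps_gt0 R n; move: NL; rewrite sqdist_frame// /kap; have := sqr_ge0 (T z); nra.
Qed.

Lemma psi_big s : 1 <= s -> 1 / 2 <= S z -> s <= logq z -> s / 8 - 36 <= psi z.
Proof.
move=> l1 S2 lL; have := psi_correction_le; rewrite ler_norml => /andP[h _].
suff : s / 8 <= S z * theta z by rewrite /psi; lra.
have := @ramp52_ge R (logq z) ltac:(lra); rewrite -/(theta z) => h2; nra.
Qed.

End At.
End Test.

(** * The arc around the concentration point *)

Section Arc.
Context {R : realType}.

(** On the half circle around p the angle measured from p is the arcsine of the
    tangential coordinate. *)
Lemma circle_ptE (z : R * R) t0 : @circle R z -> 0 < ncomp (circle_pt t0) z ->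
  z = circle_pt (t0 + asin (tcomp (circle_pt t0) z)).
Proof.
rewrite /circle/= => cz S0.
set p := circle_pt t0; have p1 : p.1 ^+ 2 + p.2 ^+ 2 = 1 by exact: cos2Dsin2.
have E := frame_sqr p1 z; rewrite cz in E.
have T1 : -1 <= tcomp p z <= 1 by apply: (@sqr_le1 _ _ (ncomp p z)); lra.
have sT : sin (asin (tcomp p z)) = tcomp p z by rewrite asinK.
have cS : cos (asin (tcomp p z)) = ncomp p z.
  rewrite cos_asin// (_ : 1 - tcomp p z ^+ 2 = ncomp p z ^+ 2); last lra.
  by rewrite sqrtr_sqr gtr0_norm.
rewrite /circle_pt cosD sinD sT cS -[cos t0]/(p.1) -[sin t0]/(p.2) /ncomp /tcomp.
rewrite [LHS]surjective_pairing; congr pair.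
  transitivity ((p.1 ^+ 2 + p.2 ^+ 2) * z.1); first by rewrite p1 mul1r.
  by ring.
transitivity ((p.1 ^+ 2 + p.2 ^+ 2) * z.2); first by rewrite p1 mul1r.
by ring.
Qed.

(** A point of the circle closer than rho = sin d to the pole has tangential
    coordinate less than sin d and lies on the side of p, so its angle from p is
    less than d and it belongs to the arc. *)
Lemma arc_near (E : set (R * R)) : E !=set0 -> union_of_arcs E ->
  exists (p : R * R) (rho : R), [/\ p.1 ^+ 2 + p.2 ^+ 2 = 1, 0 < rho, rho <= 1 &
    forall n z, @circle R z -> ~ E z -> rho ^+ 2 <= sqdist p n z].
Proof.
move=> [x Ex] [F [FA EF]].
move: Ex; rewrite EF => -[A FA_ Ax].
have [a [b [ab AE]]] := FA _ FA_.
move: Ax; rewrite AE => -[t0 /=]; rewrite in_itv/= => /andP[at0 t0b] tx.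
pose d := Num.min 1 (Num.min (t0 - a) (b - t0)).
have d0 : 0 < d by rewrite !lt_min; apply/and3P; split; lra.
have d1 : d <= 1 by rewrite ge_min lexx.
have da : d <= t0 - a by rewrite !ge_min lexx orbT.
have db : d <= b - t0 by rewrite !ge_min lexx !orbT.
have pi2 : 1 <= pi / 2 :> R by have := @pi_ge2 R; lra.
exists (circle_pt t0), (sin d); split.
- exact: cos2Dsin2.
- by rewrite sin_gt0_pi//; lra.
- exact: sin_le1.
move=> n z cz nE; rewrite leNgt; apply/negP => Nr; apply: nE.
set p := circle_pt t0 in Nr *; have p1 : p.1 ^+ 2 + p.2 ^+ 2 = 1 by exact: cos2Dsin2.
have sd0 : 0 < sin d by rewrite sin_gt0_pi//; lra.
have sd1 := sin_le1 d.
have S0 : 0 < ncomp p z.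
  by move: Nr; rewrite (sqdist_frame n p1) /kap; have := @eps_gt0 R n; have := sqr_ge0 (tcomp p z); nra.
have [Tl Tu] : - sin d < tcomp p z /\ tcomp p z < sin d.
  by move: Nr; rewrite (sqdist_frame n p1); have := sqr_ge0 (ncomp p z - kap n); split; nra.
have T1 : -1 <= tcomp p z <= 1 by lra.
set s := asin (tcomp p z).
have sI : s \in `[(- (pi / 2)), (pi / 2)].
  by rewrite in_itv/= asin_geNpi2// asin_lepi2.
have dI : d \in `[(- (pi / 2)), (pi / 2)] by rewrite in_itv/=; lra.
have NdI : - d \in `[(- (pi / 2)), (pi / 2)] by rewrite in_itv/=; lra.
have sT : sin s = tcomp p z by rewrite asinK.
have sd : s < d by rewrite -ltr_sin// sT.
have Nsd : - d < s by rewrite -ltr_sin// sT sinN.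
exists A => //; rewrite AE; exists (t0 + s).
  by rewrite /= in_itv/=; lra.
by rewrite -(circle_ptE cz).
Qed.

End Arc.

(** * The energy estimate *)

Section Final.
Context {R : realType}.

Lemma C2on_grad_wcont (U : set (R * R)) (G a b : R * R -> R) : @cdisc R `<=` U -> C2on U G ->
  (forall z, U z -> isgrad G z (a z) (b z)) ->
  {within @cdisc R, continuous a} /\ {within @cdisc R, continuous b}.
Proof.
move=> DU [g1 [g2 [h11 [h12 [h22 [gG g1h g2h ch]]]]]] ab.
split; [apply: (@subspace_eq_continuous _ _ _ g1)|apply: (@subspace_eq_continuous _ _ _ g2)].
- by move=> z /set_mem/DU Uz; rewrite /from_subspace/= -(isgrad_d1 (ab _ Uz)) (isgrad_d1 (gG _ Uz)).
- by apply: continuous_in_subspaceT => z /set_mem/DU Uz; exact: isgrad_continuous (g1h _ Uz).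
- by move=> z /set_mem/DU Uz; rewrite /from_subspace/= -(isgrad_d2 (ab _ Uz)) (isgrad_d2 (gG _ Uz)).
- by apply: continuous_in_subspaceT => z /set_mem/DU Uz; exact: isgrad_continuous (g2h _ Uz).
Qed.

Lemma trace_green_C2on (U : set (R * R)) (G a b u : R * R -> R) (Du : R * R -> R * R) w :
  @cdisc R `<=` U -> C2on U G -> (forall z, U z -> isgrad G z (a z) (b z)) ->
  L1_disc (fun z => (Du z).1) -> L1_disc (fun z => (Du z).2) -> is_trace u Du w ->
  int_circle (fun t => w (circle_pt t) * dtau G t) =
  int_disc (fun z => (Du z).1 * b z) - int_disc (fun z => (Du z).2 * a z).
Proof.
move=> DU cG ab Du1 Du2 tr; have [ca cb] := C2on_grad_wcont DU cG ab.
have [g1 [g2 [h11 [h12 [h22 [gG g1h g2h ch]]]]]] := cG.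
rewrite (trace_green DU gG g1h g2h (fun z Uz => let: And3 _ c _ := ch z Uz in c) Du1 Du2 tr).
rewrite /int_disc -RintegralB; [|exact: measurable_disc|exact: L1_mul|exact: L1_mul].
apply: eq_Rintegral => z; rewrite inE => /disc_cdisc/DU Uz.
by rewrite -(isgrad_d1 (ab _ Uz)) (isgrad_d1 (gG _ Uz)) -(isgrad_d2 (ab _ Uz)) (isgrad_d2 (gG _ Uz)).
Qed.

(** The parameter mu is left free: the part carried by g grows with n and is made
    small by a large mu. *)
Lemma amgm_int (p : R * R) n (f g : R * R -> R) (A B mu : R) : p.1 ^+ 2 + p.2 ^+ 2 = 1 ->
  L1_disc f -> {within @cdisc R, continuous g} ->
  (forall z, @cdisc R z -> `|g z| <= B * invdist p n z) -> 0 < mu ->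
  (\int[@leb2 R]_(z in @disc R) (f z ^+ 2)%:E <= A%:E)%E ->
  `|int_disc (fun z => f z * g z)| <= mu / 2 * A + B ^+ 2 / (2 * mu) * (16 * n.+2%:R).
Proof.
move=> p1 f1 cg gm mu0 fA.
have /integrableP[/measurable_EFinP mf _] := f1.
have fg := L1_mul f1 cg.
have /integrableP[mfg _] := fg.
have mN : measurable_fun2 (@disc R) (fun z => (sqdist p n z)^-1 ^+ 1) by exact: sqdistV_measurable.
rewrite -lee_fin EFin_normr_Rintegral//; last exact: measurable_disc.
apply: le_trans (le_abse_integral _ (@measurable_disc R) mfg) _.
pose K1 (z : R * R) : \bar R := ((mu / 2)%:E * (f z ^+ 2)%:E)%E.
pose K2 (z : R * R) : \bar R := ((B ^+ 2 / (2 * mu))%:E * ((sqdist p n z)^-1)%:E)%E.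
have c1 : 0 <= mu / 2 by lra.
have c2 : 0 <= B ^+ 2 / (2 * mu) by rewrite divr_ge0 ?sqr_ge0//; lra.
have mf2 : measurable_fun2 (@disc R) (fun z => (f z ^+ 2)%:E).
  by apply/measurable_EFinP; exact: measurable_funX.
have mN2 : measurable_fun2 (@disc R) (fun z => ((sqdist p n z)^-1)%:E).
  by apply/measurable_EFinP; exact: mN.
have N0 z : @disc R z -> 0 < (sqdist p n z)^-1 by move=> Dz; rewrite invr_gt0 (@sqdist_gt0 R p n p1 z (disc_cdisc Dz)).
have mK1 : measurable_fun2 (@disc R) K1 by exact: measurable_funeM.
have mK2 : measurable_fun2 (@disc R) K2 by exact: measurable_funeM.
apply: (@le_trans _ _ (\int[@leb2 R]_(z in @disc R) (K1 z + K2 z))%E).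
  apply: ge0_le_integral; [exact: measurable_disc|by []|..].
  - exact: measurableT_comp.
  - exact: emeasurable_funD.
  - move=> z Dz; rewrite /K1 /K2 -!EFinM -EFinD lee_fin normrM.
    have Cz := disc_cdisc Dz; have gz := gm _ Cz; have m2 := invdist_sqr n p1 Cz.
    have m0 := invdist_gt0 n p1 Cz; rewrite -m2; rewrite -[f z ^+ 2]real_normK ?num_real//.
    have f0 := normr_ge0 (f z).
    apply: (@le_trans _ _ (`|f z| * (B * invdist p n z))); first by rewrite ler_wpM2l.
    rewrite -subr_ge0.
    have -> : mu / 2 * `|f z| ^+ 2 + B ^+ 2 / (2 * mu) * invdist p n z ^+ 2 - `|f z| * (B * invdist p n z) =
       (mu * `|f z| - B * invdist p n z) ^+ 2 / (2 * mu) by field; rewrite gt_eqF.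
    by rewrite divr_ge0 ?sqr_ge0// mulr_ge0// ltW.
rewrite ge0_integralD//; first last.
- by move=> z Dz; rewrite mule_ge0 ?lee_fin// ltW// N0.
- by move=> z Dz; rewrite mule_ge0 ?lee_fin// sqr_ge0.
- exact: measurable_disc.
rewrite EFinD leeD//.
  rewrite ge0_integralZl_EFin//; [|exact: measurable_disc|by move=> z _; rewrite lee_fin sqr_ge0].
  by rewrite (EFinM (mu / 2) A); apply: lee_wpmul2l; rewrite ?lee_fin.
rewrite ge0_integralZl_EFin//; [|exact: measurable_disc|by move=> z Dz; rewrite lee_fin ltW// N0].
rewrite (EFinM (B ^+ 2 / (2 * mu))); apply: lee_wpmul2l; first by rewrite lee_fin.
exact: int_sqdistV.
Qed.

End Final.

Section Energy.
Context {R : realType}.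
Variables (p : R * R) (n : nat) (rho : R).
Hypothesis p1 : p.1 ^+ 2 + p.2 ^+ 2 = 1.
Hypothesis rho0 : 0 < rho.
Hypothesis rho1 : rho <= 1.
Notation eps := (@eps R n).
Notation kap := (@kap R n).
Notation sqdist := (@sqdist R p n).
Notation a := (@Va R p n).
Notation b := (@Vb R p n).
Notation psi := (@psi R p n rho).
Notation psi1 := (@psi1 R p n rho).
Notation psi2 := (@psi2 R p n rho).
Notation Hfun1 := (@Hfun1 R p n rho).
Notation Hfun2 := (@Hfun2 R p n rho).
Let DU := @cdisc_off_pole R p n p1.
Notation F := (fun z => eps ^+ 2 / sqdist z ^+ 2).

Lemma psi_Ck1 : Ck 1 psi.
Proof. by apply: (Ckon_Ck DU); apply: CkonS; apply: C2on_Ckon; exact: C2on_psi. Qed.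

Lemma F_wcont : {within @cdisc R, continuous F}.
Proof.
apply: continuous_in_subspaceT => z /set_mem Dz.
have cN := @sqdist_continuous R p n z.
apply: cvgM; first exact: cvg_cst.
apply: cvgV; first by rewrite expf_neq0// gt_eqF// sqdist_gt0.
exact: (cvgM cN cN).
Qed.

Lemma F_psi_L1 : L1_disc (fun z => F z * psi z).
Proof. by apply: L1_mul; [apply: L1_wcont; exact: F_wcont|case: psi_Ck1]. Qed.

(** A square of side eps inside the disc and at a distance of order eps from p, where
    the Jacobian is of order eps^-2. *)
Definition near_square : set (R * R) :=
  `[((1 - eps) * p.1 - eps / 2), ((1 - eps) * p.1 + eps / 2)]%classic `*`
  `[((1 - eps) * p.2 - eps / 2), ((1 - eps) * p.2 + eps / 2)]%classic.

Lemma near_square_measurable : measurable2 near_square.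
Proof. by apply: measurableX; exact: measurable_itv. Qed.

Lemma leb2_near_square : leb2 near_square = (eps ^+ 2)%:E.
Proof.
rewrite leb2_square; last by have := @eps_gt0 R n; lra.
by congr EFin; field.
Qed.

Lemma near_square_in z : eps <= 4^-1 -> near_square z ->
  [/\ @disc R z, sqdist z <= 9 * eps ^+ 2 & 1 / 2 <= ncomp p z].
Proof.
have e0 := @eps_gt0 R n => e4 [/=]; rewrite !in_itv/=.
(* Rescaled coordinates, in [-1/2, 1/2]. *)
pose v1 := (z.1 - (1 - eps) * p.1) / eps; pose v2 := (z.2 - (1 - eps) * p.2) / eps.
have E1 : z.1 = (1 - eps) * p.1 + eps * v1 by rewrite /v1; field; rewrite gt_eqF.
have E2 : z.2 = (1 - eps) * p.2 + eps * v2 by rewrite /v2; field; rewrite gt_eqF.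
rewrite E1 E2 => h1 h2.
have V1 : - (1 / 2) <= v1 <= 1 / 2 by apply/andP; split; nra.
have V2 : - (1 / 2) <= v2 <= 1 / 2 by apply/andP; split; nra.
have q1 : v1 ^+ 2 <= 1 / 4 by nra.
have q2 : v2 ^+ 2 <= 1 / 4 by nra.
pose d := v1 * p.1 + v2 * p.2.
(* With the weights 3/2 and 2/3 the arithmetic-geometric inequality for 2 v.p is
   strong enough to keep the whole square inside the disc. *)
have d1 : 2 * d <= 17 / 12.
  have : 0 <= 3 / 2 * (v1 - 2 / 3 * p.1) ^+ 2 + 3 / 2 * (v2 - 2 / 3 * p.2) ^+ 2.
    by rewrite addr_ge0// mulr_ge0 ?sqr_ge0//; lra.
  have -> : 3 / 2 * (v1 - 2 / 3 * p.1) ^+ 2 + 3 / 2 * (v2 - 2 / 3 * p.2) ^+ 2 =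
    3 / 2 * (v1 ^+ 2 + v2 ^+ 2) + 2 / 3 * (p.1 ^+ 2 + p.2 ^+ 2) - 2 * d by rewrite /d; field.
  by rewrite p1; lra.
have d2 : - (17 / 12) <= 2 * d.
  have : 0 <= 3 / 2 * (v1 + 2 / 3 * p.1) ^+ 2 + 3 / 2 * (v2 + 2 / 3 * p.2) ^+ 2.
    by rewrite addr_ge0// mulr_ge0 ?sqr_ge0//; lra.
  have -> : 3 / 2 * (v1 + 2 / 3 * p.1) ^+ 2 + 3 / 2 * (v2 + 2 / 3 * p.2) ^+ 2 =
    3 / 2 * (v1 ^+ 2 + v2 ^+ 2) + 2 / 3 * (p.1 ^+ 2 + p.2 ^+ 2) + 2 * d by rewrite /d; field.
  by rewrite p1; lra.
split.
- rewrite /disc/= E1 E2.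
  have -> : ((1 - eps) * p.1 + eps * v1) ^+ 2 + ((1 - eps) * p.2 + eps * v2) ^+ 2 =
    (1 - eps) ^+ 2 * (p.1 ^+ 2 + p.2 ^+ 2) + (1 - eps) * eps * (2 * d) +
    eps ^+ 2 * (v1 ^+ 2 + v2 ^+ 2) by rewrite /d; ring.
  rewrite p1.
  have : (1 - eps) * eps * (2 * d) <= (1 - eps) * eps * (17 / 12).
    by rewrite ler_wpM2l// mulr_ge0; lra.
  have : eps ^+ 2 * (v1 ^+ 2 + v2 ^+ 2) <= eps ^+ 2 * (1 / 2).
    by rewrite ler_wpM2l ?sqr_ge0//; lra.
  by nra.
- rewrite /sqdist /kap E1 E2.
  have -> : ((1 - eps) * p.1 + eps * v1 - (1 + eps) * p.1) ^+ 2 +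
    ((1 - eps) * p.2 + eps * v2 - (1 + eps) * p.2) ^+ 2 =
    eps ^+ 2 * (4 * (p.1 ^+ 2 + p.2 ^+ 2) + (v1 ^+ 2 + v2 ^+ 2) - 2 * (2 * d)) by rewrite /d; ring.
  by rewrite p1 [leRHS]mulrC ler_wpM2l ?sqr_ge0//; lra.
- rewrite /ncomp E1 E2.
  have -> : p.1 * ((1 - eps) * p.1 + eps * v1) + p.2 * ((1 - eps) * p.2 + eps * v2) =
    (1 - eps) * (p.1 ^+ 2 + p.2 ^+ 2) + eps * d by rewrite /d; ring.
  by rewrite p1; nra.
Qed.

Lemma pow4E : 4 ^+ n = (eps ^+ 2)^-1.
Proof.
have e0 := @eps_gt0 R n; have e2 : eps ^+ 2 != 0 by rewrite expf_neq0// gt_eqF.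
apply: (mulIf e2); rewrite mulVf// /eps -exprM mulnC exprM -exprMn.
by rewrite (_ : 4 * 2^-1 ^+ 2 = 1) ?expr1n//; field.
Qed.

(** Lower bound of logq on near_square; it grows like n ln 4. *)
Definition logscale : R := ln (4 ^+ n * (rho ^+ 2 / 9)).

Lemma logscale_le z : eps <= 4^-1 -> near_square z -> logscale <= logq p n rho z.
Proof.
move=> e4 Qz; have [Dz NQ _] := near_square_in e4 Qz.
have N0 := @sqdist_gt0 R p n p1 z (disc_cdisc Dz).
have e0 := @eps_gt0 R n; have r2 : 0 < rho ^+ 2 by rewrite exprn_gt0.
have a0 : 0 < 4 ^+ n * (rho ^+ 2 / 9) by rewrite mulr_gt0 ?exprn_gt0// divr_gt0.
have b0 : 0 < (sqdist z)^-1 * rho ^+ 2 by rewrite mulr_gt0// invr_gt0.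
rewrite /logscale /logq ler_ln ?posrE//.
have e2 : 0 < eps ^+ 2 by rewrite exprn_gt0.
rewrite pow4E (_ : _ * (rho ^+ 2 / 9) = (9 * eps ^+ 2)^-1 * rho ^+ 2); last first.
  by field; rewrite gt_eqF.
by rewrite ler_wpM2r ?sqr_ge0// lef_pV2 ?posrE// mulr_gt0.
Qed.

Lemma int_F : int_disc F <= 64.
Proof.
have e0 := @eps_gt0 R n.
have iF : L1_disc F by apply: L1_wcont; exact: F_wcont.
rewrite -lee_fin /int_disc /Rintegral fineK; last exact: (integrable_fin_num (@measurable_disc R) iF).
have -> : 64 = eps ^+ 2 * (64 * 4 ^+ n) :> R.
  rewrite pow4E.
  by field; rewrite gt_eqF.
rewrite (EFinM (eps ^+ 2)).
apply: (@le_trans _ _ ((eps ^+ 2)%:E * \int[@leb2 R]_(z in @disc R) ((sqdist z)^-1 ^+ 2)%:E)%E); last first.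
  by apply: lee_wpmul2l; [rewrite lee_fin sqr_ge0|exact: int_sqdistV2].
rewrite -ge0_integralZl_EFin.
- by under [leRHS]eq_integral do rewrite exprVn -EFinM.
- exact: measurable_disc.
- by move=> z Dz; rewrite lee_fin sqr_ge0.
- by apply/measurable_EFinP; exact: sqdistV_measurable.
- exact: sqr_ge0.
Qed.

(** On near_square, of area eps^2, the Jacobian is at least 1 / (81 eps^2) and psi is
    at least logscale / 8 - 36.  Elsewhere psi >= - 36 and the total mass of the
    Jacobian is at most 64. *)
Lemma int_Fpsi : eps <= 4^-1 -> 1 <= logscale ->
  logscale / 648 - 36 * 64 <= int_disc (fun z => F z * psi z).
Proof.
move=> e4 l1; have e0 := @eps_gt0 R n.
pose c : R := logscale / 8 / (81 * eps ^+ 2).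
have c0 : 0 <= c by rewrite /c divr_ge0// ?mulr_ge0 ?sqr_ge0//; lra.
have iF : L1_disc F by apply: L1_wcont; exact: F_wcont.
have iQ : L1_disc (fun z => \1_near_square z).
  apply: (@L1_bounded _ _ 1); first by apply: measurable_indic; exact: near_square_measurable.
  by move=> z _; rewrite indicE; case: (_ \in _); rewrite ?normr1 ?normr0.
have icQ : L1_disc (fun z => c * \1_near_square z) by exact: (integrableZl (@measurable_disc R) c iQ).
have i36 : L1_disc (fun z => 36 * F z) by exact: (integrableZl (@measurable_disc R) 36 iF).
have IQ : int_disc (fun z => \1_near_square z) = eps ^+ 2.
  rewrite /int_disc /Rintegral integral_indic; last exact: near_square_measurable.
    rewrite setIidl; first exact: (congr1 fine leb2_near_square).
    by move=> z /(near_square_in e4)[].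
  exact: measurable_disc.
apply: (@le_trans _ _ (int_disc (fun z => c * \1_near_square z - 36 * F z))); last first.
  apply: le_Rintegral.
  - exact: measurable_disc.
  - exact: (integrableB (@measurable_disc R) icQ i36).
  - exact: F_psi_L1.
  move=> z Dz; have Cz := disc_cdisc Dz; have N0 := @sqdist_gt0 R p n p1 z Cz.
  have F0 : 0 <= F z by rewrite divr_ge0 ?sqr_ge0.
  have pg := psi_ge n p1 rho0 rho1 Cz.
  rewrite indicE; case: (boolP (z \in near_square)) => [|_] /=; last first.
    by have := ler_wpM2l F0 pg; rewrite mulr0; lra.
  rewrite inE => Qz; have [_ NQ S2] := near_square_in e4 Qz.
  have pb := psi_big p1 Cz l1 S2 (logscale_le e4 Qz).
  rewrite mulr1.
  have FF : (81 * eps ^+ 2)^-1 <= F z.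
    have -> : (81 * eps ^+ 2)^-1 = eps ^+ 2 * ((9 * eps ^+ 2) ^+ 2)^-1 by field; rewrite gt_eqF.
    rewrite ler_wpM2l ?sqr_ge0// lef_pV2 ?posrE ?exprn_gt0 ?mulr_gt0 ?exprn_gt0//.
    by rewrite ler_sqr ?nnegrE ?mulr_ge0 ?sqr_ge0// ltW.
  have : c <= F z * (logscale / 8) by rewrite /c mulrC ler_wpM2r//; lra.
  by have := ler_wpM2l F0 pb; rewrite mulrBr; lra.
rewrite /int_disc RintegralB; [|exact: measurable_disc|exact: icQ|exact: i36].
rewrite RintegralZl; [|exact: measurable_disc|exact: iQ].
rewrite RintegralZl; [|exact: measurable_disc|exact: iF].
have := int_F; rewrite -/(int_disc F) -/(int_disc (fun z => \1_near_square z)) IQ.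
have -> : c * eps ^+ 2 = logscale / 648 by rewrite /c; field; rewrite gt_eqF.
by lra.
Qed.

End Energy.

Section Main.
Context {R : realType}.

Lemma norm_lin3 (al be ga x1 x2 x3 x4 x5 x6 X : R) : 0 <= al -> 0 <= ga ->
  `|x1| <= X -> `|x2| <= X -> `|x3| <= X -> `|x4| <= X -> `|x5| <= X -> `|x6| <= X ->
  al * (x1 + x2) - be * (x3 - x4) + ga * (x5 - x6) <= 2 * (al + `|be| + ga) * X.
Proof.
move=> a0 g0 h1 h2 h3 h4 h5 h6.
have B : - (be * (x3 - x4)) <= `|be| * (2 * X).
  apply: le_trans (ler_norm _) _; rewrite normrN normrM ler_wpM2l//.
  by apply: le_trans (ler_normB _ _) _; lra.
have A : al * (x1 + x2) <= al * (2 * X).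
  by rewrite ler_wpM2l//; have := ler_norm x1; have := ler_norm x2; lra.
have G : ga * (x5 - x6) <= ga * (2 * X).
  rewrite ler_wpM2l//; have := ler_norm x5; have := ler_norm (- x6).
  by rewrite normrN; lra.
by move: A B G; rewrite !mulrDr !mulrDl; lra.
Qed.

(** Test with psi.  The source term is bounded below by [int_Fpsi]; all the other
    terms are integrals over the disc of a component of Du against a component of
    the gradient of psi or of Hfun, by [trace_green_C2on]. *)
Lemma energy_bound (p : R * R) n (rho : R) (E : set (R * R)) (alpha beta gamma A mu : R)
  (u : R * R -> R) (Du : R * R -> R * R) :
  p.1 ^+ 2 + p.2 ^+ 2 = 1 -> 0 < rho -> rho <= 1 ->
  (forall z, @circle R z -> ~ E z -> rho ^+ 2 <= sqdist p n z) ->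
  0 < alpha -> 0 <= gamma -> 0 < mu ->
  weak_solution alpha beta gamma E (jac (Va p n) (Vb p n)) u Du ->
  (\int[@leb2 R]_(z in @disc R) ((Du z).1 ^+ 2 + (Du z).2 ^+ 2)%:E <= A%:E)%E ->
  @eps R n <= 4^-1 -> 1 <= logscale n rho ->
  alpha * (logscale n rho / 648 - 36 * 64) <=
  2 * (alpha + `|beta| + gamma) * (mu / 2 * A + 1000 ^+ 2 / (2 * mu) * (16 * n.+2%:R)).
Proof.
move=> p1 r0 r1 supp al0 ga0 mu0 [[Lu Du1 Du2 _] [w [tr _ weak]]] DA e4 l1.
have DU := @cdisc_off_pole R p n p1.
have /integrableP[/measurable_EFinP mD1 _] := Du1.
have /integrableP[/measurable_EFinP mD2 _] := Du2.
have A1 : (\int[@leb2 R]_(z in @disc R) ((Du z).1 ^+ 2)%:E <= A%:E)%E.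
  apply: le_trans DA; apply: ge0_le_integral.
  - exact: measurable_disc.
  - by move=> z _; rewrite lee_fin sqr_ge0.
  - by apply/measurable_EFinP; exact: measurable_funX.
  - by apply/measurable_EFinP; apply: measurable_funD; exact: measurable_funX.
  - by move=> z _; rewrite lee_fin lerDl sqr_ge0.
have A2 : (\int[@leb2 R]_(z in @disc R) ((Du z).2 ^+ 2)%:E <= A%:E)%E.
  apply: le_trans DA; apply: ge0_le_integral.
  - exact: measurable_disc.
  - by move=> z _; rewrite lee_fin sqr_ge0.
  - by apply/measurable_EFinP; exact: measurable_funX.
  - by apply/measurable_EFinP; apply: measurable_funD; exact: measurable_funX.
  - by move=> z _; rewrite lee_fin lerDr sqr_ge0.
have gpsi z : off_pole p n z -> isgrad (psi p n rho) z (psi1 p n rho z) (psi2 p n rho z).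
  exact: isgrad_psi.
have gH z : off_pole p n z -> isgrad (Hfun p n rho) z (Hfun1 p n rho z) (Hfun2 p n rho z).
  exact: isgrad_Hfun.
have cpsi : C2on (off_pole p n) (psi p n rho) by exact: C2on_psi.
have cH : C2on (off_pole p n) (Hfun p n rho) by exact: C2on_Hfun.
have [c1 c2] := C2on_grad_wcont DU cpsi gpsi.
have [c3 c4] := C2on_grad_wcont DU cH gH.
have := weak (psi p n rho) (psi_Ck1 n p1 r0) _.
have psi_supp z : @circle R z -> ~ E z -> psi p n rho z = 0.
  move=> cz nE; have Dz : @cdisc R z by rewrite /cdisc/= cz.
  by apply: psi0 => //; exact: supp.
move=> /(_ psi_supp).
rewrite (trace_green_C2on DU cpsi gpsi Du1 Du2 tr).
have -> : int_circle (fun t => w (circle_pt t) * psi p n rho (circle_pt t)) =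
  int_circle (fun t => w (circle_pt t) * dtau (Hfun p n rho) t).
  by congr int_circle; apply/funext => t; rewrite dtau_Hfun.
rewrite (trace_green_C2on DU cH gH Du1 Du2 tr).
have L11 := L1_mul Du1 c1; have L22 := L1_mul Du2 c2.
have LF := @F_psi_L1 R p n rho p1 r0.
have -> : int_disc (fun z => (Du z).1 * d1 (psi p n rho) z + (Du z).2 * d2 (psi p n rho) z
      - jac (Va p n) (Vb p n) z * psi p n rho z) =
    int_disc (fun z => (Du z).1 * psi1 p n rho z) + int_disc (fun z => (Du z).2 * psi2 p n rho z)
    - int_disc (fun z => @eps R n ^+ 2 / sqdist p n z ^+ 2 * psi p n rho z).
  rewrite /int_disc -RintegralD; [|exact: measurable_disc|exact: L11|exact: L22].
  rewrite -RintegralB; [|exact: measurable_disc| |exact: LF].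
    apply: eq_Rintegral => z; rewrite inE => /disc_cdisc/DU Uz.
    by rewrite (isgrad_d1 (gpsi _ Uz)) (isgrad_d2 (gpsi _ Uz)) jacV.
  exact: (integrableD (@measurable_disc R) L11 L22).
have lower := int_Fpsi p1 r0 r1 e4 l1.
set I0 := int_disc (fun z => _ * psi p n rho z) in lower *.
set X := mu / 2 * A + _.
have B g f : L1_disc f -> (\int[@leb2 R]_(z in @disc R) (f z ^+ 2)%:E <= A%:E)%E ->
    {within @cdisc R, continuous g} ->
    (forall z, @cdisc R z -> `|g z| <= 1000 * invdist p n z) ->
    `|int_disc (fun z => f z * g z)| <= X.
  by move=> f1 fA cg gm; exact: (amgm_int p1 f1 cg gm mu0 fA).
move=> weak0.
have E0 : alpha * I0 = alpha *
     (int_disc (fun z => (Du z).1 * psi1 p n rho z) + int_disc (fun z => (Du z).2 * psi2 p n rho z))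
  - beta * (int_disc (fun z => (Du z).1 * psi2 p n rho z) - int_disc (fun z => (Du z).2 * psi1 p n rho z))
  + gamma * (int_disc (fun z => (Du z).1 * Hfun2 p n rho z) - int_disc (fun z => (Du z).2 * Hfun1 p n rho z)).
  by apply/eqP; rewrite eq_sym -subr_eq0; apply/eqP; rewrite -[RHS]weak0; ring.
apply: (@le_trans _ _ (alpha * I0)); first by rewrite ler_wpM2l// ltW.
rewrite E0; apply: norm_lin3 => //; first exact: ltW.
- by apply: B => // z Dz; exact: psi1_le.
- by apply: (@B _ (fun z => (Du z).2)) => // z Dz; exact: psi2_le.
- by apply: B => // z Dz; exact: psi2_le.
- by apply: (@B _ (fun z => (Du z).2)) => // z Dz; exact: psi1_le.
- by apply: B => // z Dz; exact: Hfun2_le.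
- by apply: (@B _ (fun z => (Du z).2)) => // z Dz; exact: Hfun1_le.
Qed.

End Main.

(** * Divergence of the energies *)

Lemma L2_norm_ge (R : realType) (Du : R * R -> R * R) (M : R) :
  ((M ^+ 2)%:E <= \int[@leb2 R]_(z in @disc R) ((Du z).1 ^+ 2 + (Du z).2 ^+ 2)%:E)%E ->
  (M%:E <= L2_norm Du)%E.
Proof.
move=> h; rewrite /L2_norm.
apply: (@le_trans _ _ ((M ^+ 2)%:E `^ 2^-1)%E).
  by rewrite poweR_EFin powR12_sqrt ?sqr_ge0// sqrtr_sqr lee_fin ler_norm.
apply: gt0_ler_poweR => //; rewrite in_itv/= leey andbT ?lee_fin ?sqr_ge0//.
by apply: integral_ge0 => z _; rewrite lee_fin addr_ge0// sqr_ge0.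
Qed.

Lemma linear_growth (R : realFieldType) (al l c k j Q N : R) :
  0 < al -> 0 < l -> 0 < k ->
  al * ((N * l + c) / k - j) <= Q + al * l * (N + 2) / (2 * k) ->
  N <= (Q + al * j - al * c / k + al * l / k) * (2 * k) / (al * l).
Proof.
move=> al0 l0 k0 h; have al_l : 0 < al * l by rewrite mulr_gt0.
rewrite ler_pdivlMr// -ler_pdivrMr ?mulr_gt0//.
rewrite -subr_ge0; move: h; rewrite -subr_ge0 => h.
rewrite (_ : _ - _ = Q + al * l * (N + 2) / (2 * k) - al * ((N * l + c) / k - j))//.
by field; rewrite gt_eqF.
Qed.

Theorem theorem1p3 (R : realType) (E : set (R * R)) (alpha beta gamma : R) :
  E !=set0 -> union_of_arcs E ->
  (0 < arc_length E)%E -> (arc_length E < (2 * pi)%:E)%E ->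
  0 < alpha -> 0 <= gamma ->
  exists (a b : nat -> R * R -> R) (C : R),
    (forall n, Cinfty (a n) /\ Cinfty (b n)) /\
    (forall n, (lorentz21 (grad_norm (a n) (b n)) < C%:E)%E) /\
    (forall (u : nat -> R * R -> R) (Du : nat -> R * R -> R * R),
       (forall n, weak_solution alpha beta gamma E
                    (jac (a n) (b n)) (u n) (Du n)) ->
       (L2_norm (Du n) @[n --> \oo] --> +oo)%E).
Proof.
move=> En Eu _ _ al0 ga0.
have [p [rho [p1 r0 r1 supp]]] := arc_near En Eu.
exists (fun n => Va p n), (fun n => Vb p n), 33; split; [|split].
- by move=> n; exact: Cinfty_V.
- by move=> n; apply: le_lt_trans (lorentzV n p1) _; rewrite lte_fin; lra.
move=> u Du sol; apply/cvgeyPge => M.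
pose K : R := 2 * (alpha + `|beta| + gamma).
have [Z Z0 ZE] : exists2 Z : R, 0 < Z &
    forall m k : R, m != 0 -> 1000 ^+ 2 / (2 * m) * (16 * k) = Z / m * k.
  have : 0 < 1000 :> R by rewrite ltr0n.
  move: (1000 : R) => B B0; exists (B ^+ 2 * 8); first by rewrite mulr_gt0// exprn_gt0.
  by move=> m k m0; field.
pose l4 : R := ln 4.
pose c0 : R := ln (rho ^+ 2 / 9).
have K0 : 0 < K by rewrite /K; have := normr_ge0 beta; lra.
have l40 : 0 < l4 by rewrite /l4 ln_gt0//; lra.
have k0 : 0 < 648 :> R by rewrite ltr0n.
have k2 : 0 < 2 * 648 :> R by apply: mulr_gt0 k0; rewrite ltr0n.
(* With this mu the term linear in n on the right of the energy bound is half of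
   the one on the left, alpha * l4 * n / 648. *)
pose mu : R := K * Z * (2 * 648) / (alpha * l4).
have mu0 : 0 < mu := divr_gt0 (mulr_gt0 (mulr_gt0 K0 Z0) k2) (mulr_gt0 al0 l40).
pose Q : R := K * mu * M ^+ 2 / 2.
(* The bound on n that [linear_growth] yields when the energy is at most M^2. *)
pose N0 : R := (Q + alpha * (36 * 64) - alpha * c0 / 648 + alpha * l4 / 648) * (2 * 648) / (alpha * l4).
near=> n.
have n2 : (2 <= n)%N by near: n; exact: nbhs_infty_ge.
have nl : (1 - c0) / l4 <= n%:R by near: n; exact: nbhs_infty_ger.
have nN : N0 + 1 <= n%:R by near: n; exact: nbhs_infty_ger.
have e4 : @eps R n <= 4^-1.
  rewrite (_ : 4^-1 = 2^-1 ^+ 2 :> R); last by field.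
  by rewrite /eps ler_wiXn2l ?invr_ge0// invf_le1// ler1n.
have lamE : logscale n rho = n%:R * l4 + c0.
  have r9 : 0 < rho ^+ 2 / 9 by rewrite divr_gt0// exprn_gt0.
  by rewrite /logscale lnM ?posrE ?exprn_gt0// lnXn// mulr_natl.
have l1 : 1 <= logscale n rho.
  by move: nl; rewrite ler_pdivrMr// lamE lerBlDr.
(* If the energy were at most M^2, the energy bound would give n <= N0. *)
apply: L2_norm_ge; rewrite leNgt; apply/negP => /ltW hA.
have := energy_bound p1 r0 r1 (supp n) al0 ga0 mu0 (sol n) hA e4 l1.
rewrite -/K lamE ZE ?gt_eqF//.
have -> : K * (mu / 2 * M ^+ 2 + Z / mu * n.+2%:R) =
    Q + alpha * l4 * (n%:R + 2) / (2 * 648).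
  rewrite /Q /mu -[n.+2]addn2 natrD; move: (648 : R) k0 => k k0.
  by field; rewrite !gt_eqF.
move=> /(linear_growth al0 l40 k0); rewrite -/N0 => nN0.
by have := le_trans nN nN0; rewrite gerDl ler10.
Unshelve. all: by end_near.
Qed.
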